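(* Let $G=(V,E)$ be a finite simple connected graph with $n=|V|$ and $|E|=m$, and suppose $\Theta(G)\neq\emptyset$. Let $k_G=\operatorname{lcm}\{\operatorname{den}(x): x\text{ a vertex of }\Theta(G)\}$. Let $\mathcal C$ range over all sets of $m$ equations with linearly independent coefficient vectors that are selected from some system of linear equations in $x\in\mathbb R^E$ of the form $$x(E)=n-1,\qquad x(F)=r_G(F)\ \ (F\in\mathcal L),\qquad x_f=0\ \ (f\in Z),\qquad d_v(x)=2\ \ (v\in D),$$ where $\mathcal L\subseteq 2^E\setminus\{\emptyset,E\}$ is a laminar family, $Z\subseteq E$ and $D\subseteq V$; for each such $\mathcal C$ let $x_{\mathcal C}\in\mathbb R^E$ denote the unique solution of the $m$ equations in $\mathcal C$. Then $$k_G=\min\{k\in\mathbb N: k\,\Theta(G)\text{ is a lattice polytope}\}=\operatorname{lcm}\{\operatorname{den}(x_{\mathcal C}): x_{\mathcal C}\in\Theta(G)\},$$ where the last least common multiple is over all such $\mathcal C$ with $x_{\mathcal C}\in\Theta(G)$.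
   Context: $\mathbb N$ denotes the positive integers. For $x\in\mathbb R^E$ and $F\subseteq E$, $x(F)=\sum_{e\in F}x_e$; for $v\in V$, $d_v(x)=\sum_{u:\,uv\in E}x_{uv}$. For $F\subseteq E$, $r_G(F)=n-\kappa_G(F)$, where $\kappa_G(F)$ is the number of connected components of the spanning subgraph $(V,F)$. The spanning tree polytope is $P(G)=\operatorname{conv}\{\chi^T: T \text{ a spanning tree of } G\}\subseteq\mathbb R^E$, where $\chi^T\in\{0,1\}^E$ is the incidence vector of the edge set of $T$. The matching polytope is $M(G)=\operatorname{conv}\{\chi^M: M\subseteq E\text{ a matching}\}$. The tree double matching polytope is $\Theta(G)=P(G)\cap 2M(G)$; equivalently, $\Theta(G)=P(G)\cap\{x: d_v(x)\le 2\text{ for every }v\in V\}$. A family $\mathcal L\subseteq 2^E$ is laminar if any two of its members are either disjoint or one contains the other. For a rational vector $x\in\mathbb Q^E$, $\operatorname{den}(x)$ is the least positive integer $p$ with $px\in\mathbb Z^E$. A polytope is a lattice polytope if all its vertices are integer points. *)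

(* Defs.v *)
From HB Require Import structures.
From mathcomp Require Import all_boot all_order all_algebra.
From mathcomp Require Import classical_sets reals.

Set Implicit Arguments.
Unset Strict Implicit.
Unset Printing Implicit Defensive.

Import GRing.Theory Num.Theory.

Local Open Scope ring_scope.

Record sgraph (V : finType) := SGraph {
  edges : {set {set V}};
  edges_card2 : forall e : {set V}, e \in edges -> #|e| = 2%N }.

Definition edge (V : finType) (G : sgraph V) := {e : {set V} | e \in edges G}.

Section Graph.
Variables (V : finType) (G : sgraph V).
Implicit Types (F T M : {set edge G}) (v : V).

(* Adjacency in the spanning subgraph (V, F). *)
Definition adj F : rel V := [rel u v | [exists e in F, val e == [set u; v]]].

Definition ncomp F : nat := n_comp (adj F) V.

Definition rk F : nat := (#|V| - ncomp F)%N.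

Definition connected_spanning F : Prop :=
  (0 < #|V|)%N /\ forall u v : V, connect (adj F) u v.

(* A cycle is a cyclic sequence of at least 3 distinct vertices; the size
   condition rules out walking back and forth along a single edge. *)
Definition acyclic F : Prop :=
  forall c : seq V, (2 < size c)%N -> ~ ucycle (adj F) c.

Definition spanning_tree T : Prop := connected_spanning T /\ acyclic T.

Definition matching M : Prop :=
  forall e f : edge G, e \in M -> f \in M -> e != f ->
    [disjoint val e & val f].

Definition star v : {set edge G} := [set e : edge G | v \in val e].

Definition laminar (L : {set {set edge G}}) : Prop :=
  forall A B, A \in L -> B \in L ->
    [\/ [disjoint A & B], A \subset B | B \subset A].

End Graph.

Definition connected_graph (V : finType) (G : sgraph V) : Prop :=
  connected_spanning [set: edge G].

(* The scalars are R^o, so that vectors form a vectType and [free] applies. *)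
Notation vec R I := {ffun I -> R^o}.

Section Polytopes.
Variables (R : realType) (I : finType).
Implicit Types (P : set (vec R I)) (x : vec R I).
Local Open Scope classical_set_scope.

Definition chi (F : {set I}) : vec R I := [ffun e => (e \in F)%:R].

Definition conv P : set (vec R I) :=
  [set x | exists (k : nat) (p : 'I_k -> vec R I) (w : 'I_k -> R),
     [/\ forall i, P (p i), forall i, 0 <= w i, \sum_i w i = 1
       & x = \sum_i w i *: p i]].

Definition dilate (k : nat) P : set (vec R I) := [set k%:R *: x | x in P].

Definition vertices P : set (vec R I) :=
  [set x | P x /\ forall (y z : vec R I) (t : R), P y -> P z -> 0 < t < 1 ->
     x = t *: y + (1 - t) *: z -> y = x /\ z = x].

Definition integral x : Prop := forall e, (x e : R) \is a Num.int.

Definition lattice_polytope P : Prop := forall x, vertices P x -> integral x.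

(* The least positive integer in A, and 0 if A has no positive element. *)
Definition least_pos (A : set nat) : nat :=
  xget 0%N [set p | [/\ (0 < p)%N, A p &
                      forall q : nat, (0 < q)%N -> A q -> (p <= q)%N]].

(* [den x] is 0 when x is not rational.  As 0 divides only 0, [lcm_set] is then
   0 as well: a positive lcm of denominators certifies that all the vectors
   involved are rational. *)
Definition den x : nat := least_pos [set p | integral (p%:R *: x)].

(* The least positive common multiple, and 0 if there is none. *)
Definition lcm_set (A : set nat) : nat :=
  least_pos [set k | forall a, A a -> (a %| k)%N].

(* The linear equation \sum_e a e * x e = b is encoded as the pair (a, b). *)
Definition equation : Type := (vec R I * R)%type.

Definition solves x (q : equation) : Prop := \sum_e q.1 e * x e = q.2.

End Polytopes.

Section Theta.
Variables (R : realType) (V : finType) (G : sgraph V).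
Local Open Scope classical_set_scope.

Definition spanning_tree_polytope : set (vec R (edge G)) :=
  conv [set chi R T | T in [set T | spanning_tree T]].

Definition matching_polytope : set (vec R (edge G)) :=
  conv [set chi R M | M in [set M | matching M]].

Definition Theta : set (vec R (edge G)) :=
  spanning_tree_polytope `&` dilate 2 matching_polytope.

(* x(F) is the linear form with coefficient vector [chi R F]; in particular
   d_v(x) = x(star v). *)
Definition theta_system (L : {set {set edge G}}) (Z : {set edge G})
    (D : {set V}) : seq (equation R (edge G)) :=
  (chi R [set: edge G]%SET, #|V|%:R - 1)
    :: [seq (chi R F, (rk F)%:R) | F <- enum L]
    ++ [seq (chi R [set f]%SET, 0) | f <- enum Z]
    ++ [seq (chi R (star G v), 2) | v <- enum D].

Definition admissible (C : #|{: edge G}|.-tuple (equation R (edge G))) : Prop :=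
  free [seq q.1 | q <- C] /\
  exists (L : {set {set edge G}}) (Z : {set edge G}) (D : {set V}),
    [/\ laminar L, finset.set0 \notin L, finset.setT \notin L
      & {subset C <= theta_system L Z D}].

Definition system_points : set (vec R (edge G)) :=
  [set x | exists2 C, admissible C & forall q, q \in C -> solves x q].

Definition kG : nat := lcm_set [set den x | x in vertices Theta].

End Theta.

Arguments spanning_tree_polytope R {V} G _.
Arguments matching_polytope R {V} G _.
Arguments Theta R {V} G _.
Arguments system_points R {V} G _.

(* Main.v *)
From HB Require Import structures.
Require Import Defs.
From mathcomp Require Import classical_sets reals.
From mathcomp Require Import all_boot all_order all_algebra.
From mathcomp Require Import perm.
From mathcomp Require Import zify ring lra.

(** Write n for the number of vertices, m for the number of edges and rk for the
    rank.  Everything follows from a description of Theta by inequalities: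
    x >= 0, x(E) = n - 1, x(F) <= rk F for all F, and x(star v) <= 2 for all v
    (ThetaP).  This takes two theorems of Edmonds, on the spanning tree polytope
    (spanning_tree_polytopeP) and on the matching polytope (matching_polytopeP):
    if x lies in the spanning tree polytope and has all degrees at most 2, then
    x / 2 satisfies the odd set inequalities, as the edges spanned by U have
      rank
    at most #|U| - 1.

    A bounded polyhedron is the convex hull of its basic points, those whose
    tight constraints have normals spanning the space (sub_conv_basic_points).
    So for each of the two theorems it is enough to see that basic points are
    incidence vectors.  For trees this is an exchange argument on tight sets
    (basic_tree_integral).  For matchings it comes from Lovasz's proof: all
    maximum-weight matchings lie on one of the faces of the description
    (matching_faces), which rests on a weighted version of Gallai's lemma
    (never_both_missed_trans).

    The vertices of Theta are then exactly the points x_C that lie in Theta.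
    Such an x_C is the only solution of equations that define faces of Theta,
    hence a vertex (system_points_vertices).  Conversely, a vertex is determined
    by its tight constraints; as rk is submodular, the tight sets are closed
    under union and intersection, and those of a maximal chain, which is a
    laminar family, generate all of them (maximal_chain_span).  Choosing m
    independent equations among them gives vertices_system_points.

    Finally, each x_C solves a regular 0/1 system with an integral right-hand
    side, so that by Cramer's rule its denominator is at most m!
    (regular_system_rational).  Hence the least common multiples are positive,
    and k Theta is a lattice polytope exactly when k is a multiple of the
    denominators of all vertices (vertices_dilate, den_dvd). *)

Set Implicit Arguments.
Unset Strict Implicit.
Unset Printing Implicit Defensive.

Import Order.TTheory GRing.Theory Num.Theory.

(** * Polyhedra and their basic points *)

Section Polyhedra.
Variables (R : realType) (I : finType).
Implicit Types (a d x y z w : vec R I) (q : equation R I)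
  (cs : seq (equation R I)) (P : set (vec R I)).
Local Open Scope ring_scope.

Definition dot a x : R := \sum_e a e * x e.

Lemma dotC a x : dot a x = dot x a.
Proof. by apply: eq_bigr => e _; rewrite mulrC. Qed.

Lemma dotDr a x y : dot a (x + y) = dot a x + dot a y.
Proof. by rewrite -big_split; apply: eq_bigr => e _; rewrite ffunE mulrDr. Qed.

Lemma dotZr a (t : R) x : dot a (t *: x) = t * dot a x.
Proof. by rewrite mulr_sumr; apply: eq_bigr => e _; rewrite ffunE mulrCA. Qed.

Lemma dotNr a x : dot a (- x) = - dot a x.
Proof. by rewrite -scaleN1r dotZr mulN1r. Qed.

Lemma dotBr a x y : dot a (x - y) = dot a x - dot a y.
Proof. by rewrite dotDr dotNr. Qed.

Lemma dot0r a : dot a 0 = 0.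
Proof. by rewrite -(scale0r 0) dotZr mul0r. Qed.

Lemma dotDl a d x : dot (a + d) x = dot a x + dot d x.
Proof. by rewrite !(dotC _ x) dotDr. Qed.

Lemma dotZl (t : R) a x : dot (t *: a) x = t * dot a x.
Proof. by rewrite !(dotC _ x) dotZr. Qed.

Lemma dotNl a x : dot (- a) x = - dot a x.
Proof. by rewrite !(dotC _ x) dotNr. Qed.

Lemma dotBl a d x : dot (a - d) x = dot a x - dot d x.
Proof. by rewrite !(dotC _ x) dotBr. Qed.

Lemma dot0l x : dot 0 x = 0.
Proof. by rewrite dotC dot0r. Qed.

Lemma dot_sumr a (k : nat) (p : 'I_k -> vec R I) :
  dot a (\sum_i p i) = \sum_i dot a (p i).
Proof. by apply: (big_morph (dot a)) => [x y|]; rewrite ?dotDr ?dot0r. Qed.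

Lemma dot_suml (J : eqType) (r : seq J) (F : J -> vec R I) x :
  dot (\sum_(j <- r) F j) x = \sum_(j <- r) dot (F j) x.
Proof.
by apply: (big_morph (fun a => dot a x)) => [a d|]; rewrite ?dotDl ?dot0l.
Qed.

Lemma dot_self0 x : dot x x = 0 -> x = 0.
Proof.
move=> x0; apply/ffunP => e; rewrite ffunE; apply/eqP.
rewrite -sqrf_eq0 expr2; apply/eqP/(psumr_eq0P _ x0) => // f _.
by rewrite -expr2 sqr_ge0.
Qed.

Lemma dot_chi (F : {set I}) x : dot (chi R F) x = \sum_(e in F) x e.
Proof.
rewrite big_mkcond; apply: eq_bigr => e _; rewrite ffunE.
by case: (e \in F); rewrite ?mul1r ?mul0r.
Qed.

Lemma dot_chi1 e x : dot (chi R [set e]%SET) x = x e.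
Proof. by rewrite dot_chi big_set1. Qed.

Lemma dot_chi_chi (F T : {set I}) : dot (chi R F) (chi R T) = #|F :&: T|%:R.
Proof.
rewrite dot_chi -sum1_card big_mkcond [in RHS]big_mkcond /= natr_sum.
by apply: eq_bigr => e _; rewrite inE ffunE; case: (e \in F); case: (e \in T).
Qed.

Lemma conv_point P x : P x -> conv P x.
Proof.
move=> Px; exists 1%N, (fun=> x), (fun=> 1).
by split=> //; rewrite big_ord1 ?scale1r.
Qed.

Lemma conv_convex P x y (t : R) : 0 <= t <= 1 ->
  conv P x -> conv P y -> conv P (t *: x + (1 - t) *: y).
Proof.
move=> /andP[t0 t1] [k [p [u [Pp u0 u1 ->]]]] [l [r [v [Pr v0 v1 ->]]]].
pose pr i := match split i with inl j => p j | inr j => r j end.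
pose uv i := match split i with inl j => t * u j | inr j => (1 - t) * v j end.
exists (k + l)%N, pr, uv; split.
- by move=> i; rewrite /pr; case: split.
- by move=> i; rewrite /uv; case: split => j; rewrite mulr_ge0 ?subr_ge0.
- rewrite big_split_ord /= /uv.
  under eq_bigr => i _ do rewrite (unsplitK (inl i)).
  under [X in _ + X]eq_bigr => i _ do rewrite (unsplitK (inr i)).
  by rewrite -!mulr_sumr u1 v1 !mulr1 addrC subrK.
- rewrite big_split_ord /= /uv /pr.
  under [X in _ = X + _]eq_bigr => i _ do rewrite (unsplitK (inl i)) -scalerA.
  under [X in _ = _ + X]eq_bigr => i _ do rewrite (unsplitK (inr i)) -scalerA.
  by rewrite -!scaler_sumr.
Qed.

Lemma conv_le P a (b : R) :
  (forall p, P p -> dot a p <= b) -> forall x, conv P x -> dot a x <= b.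
Proof.
move=> Pb x [k [p [u [Pp u0 u1 ->]]]]; rewrite dot_sumr -[b]mul1r -u1 mulr_suml.
by apply: ler_sum => i _; rewrite dotZr ler_wpM2l ?Pb.
Qed.

Lemma conv_mono P (Q : set (vec R I)) :
  (forall x, P x -> Q x) -> forall x, conv P x -> conv Q x.
Proof.
move=> PQ x [k [p [u [Pp u0 u1 ->]]]].
by exists k, p, u; split=> // i; apply: PQ.
Qed.

Lemma segment_combination x d (t s : R) : t + s != 0 ->
  x = (s / (t + s)) *: (x + t *: d) + (1 - s / (t + s)) *: (x + s *: - d).
Proof.
move=> ts.
have vE (a b : R) : (a *: (x + t *: d) + b *: (x + s *: - d)) =
    (a + b) *: x + (a * t - b * s) *: d.
  by rewrite !scalerDr !scalerDl !scaleNr !scalerN !scalerA addrACA.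
rewrite vE subrKC scale1r [X in _ + X *: d](_ : _ = 0) ?scale0r ?addr0 //.
by field.
Qed.

Definition polyhedron cs : set (vec R I) :=
  [set x | forall q, q \in cs -> dot q.1 x <= q.2]%classic.

Definition tight cs x := [seq q <- cs | dot q.1 x == q.2].

(** Triviality of the recession cone: for a nonempty polyhedron it is equivalent
    to boundedness, and it is what guarantees that a line leaves the polyhedron
    in both directions. *)
Definition bounded cs :=
  forall d, (forall q, q \in cs -> dot q.1 d <= 0) -> d = 0.

(** Equivalently, the normals of the constraints span the whole space. *)
Definition separating cs :=
  forall d, (forall q, q \in cs -> dot q.1 d = 0) -> d = 0.

Definition basic_points cs : set (vec R I) :=
  [set x | polyhedron cs x /\ separating (tight cs x)]%classic.

Lemma seq_argmin (T : eqType) (s : seq T) (f : T -> R) (i0 : T) : i0 \in s ->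
  exists2 i, i \in s & forall j, j \in s -> f i <= f j.
Proof.
elim: s i0 => // a s IHs i0 _; case: s IHs => [_|b s /(_ b) IHs].
  by exists a; rewrite ?mem_head // => j; rewrite inE => /eqP->.
case: IHs => [|i si imin]; first exact: mem_head.
have [fai|fia] := leP (f a) (f i).
  exists a; first exact: mem_head.
  by move=> j; rewrite inE => /predU1P[->//|/imin]; apply: le_trans.
exists i; first by rewrite inE si orbT.
by move=> j; rewrite inE => /predU1P[->|/imin//]; apply: ltW.
Qed.

(** Move from x in a direction that keeps the tight constraints tight until
    another one becomes tight.  This happens because q0 bounds the step. *)
Lemma polyhedron_step cs x d q0 : polyhedron cs x ->
  (forall q, q \in tight cs x -> dot q.1 d = 0) ->
  q0 \in cs -> 0 < dot q0.1 d ->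
  exists2 t : R, 0 < t & polyhedron cs (x + t *: d) /\
    (size (tight cs x) < size (tight cs (x + t *: d)%R))%N.
Proof.
move=> Px d0 q0cs q0d.
have slack q : q \in cs -> 0 < dot q.1 d -> dot q.1 x < q.2.
  move=> qcs qd; rewrite lt_neqAle Px // andbT; apply: contraTneq qd => e.
  by rewrite d0 ?ltxx // mem_filter e eqxx.
pose f q := (q.2 - dot q.1 x) / dot q.1 d.
have [|q1] := @seq_argmin _ [seq q <- cs | 0 < dot q.1 d] f q0.
  by rewrite mem_filter q0d.
rewrite mem_filter => /andP[q1d q1cs] q1min.
have f0 : 0 < f q1 by rewrite divr_gt0 // subr_gt0 slack.
exists (f q1) => //; set y := x + _.
have dy q : dot q.1 y = dot q.1 x + f q1 * dot q.1 d by rewrite dotDr dotZr.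
split=> [q qcs|].
  rewrite dy; have [qd|qd] := ltP 0 (dot q.1 d); last first.
    by rewrite -[q.2]addr0 lerD ?Px // mulr_ge0_le0 // ltW.
  rewrite -lerBrDl -ler_pdivlMr //; apply: q1min.
  by rewrite mem_filter qd.
have sub : subpred (fun q => (q \in cs) && (dot q.1 x == q.2))
                   (fun q => (q \in cs) && (dot q.1 y == q.2)).
  move=> q /andP[qcs qx]; rewrite qcs dy d0 ?mulr0 ?addr0 //.
  by rewrite mem_filter qx.
have q1y : dot q1.1 y = q1.2.
  by rewrite dy /f divfK ?gt_eqF // addrC subrK.
rewrite !size_filter.
have {1}-> : count (fun q => dot q.1 y == q.2) cs =
   (count (fun q => dot q.1 x == q.2) cs +
    count (fun q => (dot q.1 y == q.2) && (dot q.1 x != q.2)) cs)%N.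
  rewrite -(count_predUI (fun q => dot q.1 x == q.2)).
  rewrite [X in (_ + X)%N](_ : _ = 0)%N ?addn0; last first.
    by apply/eqP; rewrite -leqn0 leqNgt -has_count; apply/hasPn => q _ /=;
      case: eqP; rewrite ?andbF.
  apply: eq_in_count => q qcs /=.
  have := sub q; rewrite qcs /=; case: (dot q.1 x == q.2) => [->//|_].
  by rewrite andbT.
rewrite -addn1 leq_add2l -has_count; apply/hasP; exists q1 => //=.
by rewrite q1y eqxx /= lt_eqF ?slack.
Qed.

Lemma polyhedron_segment cs x d : bounded cs -> polyhedron cs x ->
  (forall q, q \in tight cs x -> dot q.1 d = 0) -> d != 0 ->
  exists2 t : R, 0 < t & polyhedron cs (x + t *: d) /\
    (size (tight cs x) < size (tight cs (x + t *: d)%R))%N.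
Proof.
move=> bcs Px d0 dn0.
have [/allP/= dle|/allPn[q qcs]] := boolP (all (fun q => dot q.1 d <= 0) cs).
  by case/eqP: dn0; apply: bcs.
by rewrite -ltNge => qd; apply: polyhedron_step qd.
Qed.

(** A point inside the segment cut out of a polyhedron by a line along which
    the tight constraints stay tight lies between two points with more tight
    constraints; induction on their number yields the finite-dimensional
    Krein-Milman theorem, with basic points in place of extreme ones. *)
Lemma sub_conv_basic_points cs x :
  bounded cs -> polyhedron cs x -> conv (basic_points cs) x.
Proof.
move=> bcs; have [k] := ubnP (size cs - size (tight cs x))%N.
have tle y : (size (tight cs y) <= size cs)%N by rewrite size_filter count_size.
elim: k x => // k IHk x; rewrite ltnS => xk Px.
have IH y : (size (tight cs x) < size (tight cs y))%N -> polyhedron cs y ->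
    conv (basic_points cs) y.
  by move=> xy; apply: IHk;
    rewrite (leq_trans _ xk) // ltn_sub2l ?(leq_trans xy).
case: (boolp.EM (separating (tight cs x))) => [sx|nsx]; first exact: conv_point.
have [d /boolp.not_implyP[d0 /eqP dn0]] := (boolp.existsNP _).2 nsx.
have [t t0 [Pt /IH/(_ Pt) ct]] := polyhedron_segment bcs Px d0 dn0.
have [||s s0 [Ps /IH/(_ Ps) cS]] := @polyhedron_segment cs x (- d) bcs Px.
- by move=> q /d0 e; rewrite dotNr e oppr0.
- by rewrite oppr_eq0.
have ts : t + s != 0 by rewrite gt_eqF ?addr_gt0.
rewrite (segment_combination x d ts).
apply: conv_convex => //; apply/andP; split.
  by rewrite divr_ge0 ?addr_ge0 // ltW.
by rewrite ler_pdivrMr ?addr_gt0 // mul1r lerDr ltW.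
Qed.

Section Facets.
Variables (K : finType) (s : K -> vec R I) (k0 : K) (cs : seq (equation R I)).

Definition maximizers w : {set K} :=
  [set k | [forall l, dot w (s l) <= dot w (s k)]].

Hypothesis s_poly : forall k, polyhedron cs (s k).

(** Every nonzero objective function has its maximizers on a common proper
  face. *)
Hypothesis faces : forall w, w != 0 -> exists2 q, q \in cs &
  (forall k, k \in maximizers w -> dot q.1 (s k) = q.2) /\
  (exists k, dot q.1 (s k) != q.2).

(** Subtract from the objective function the normal of a face that contains all
    its maximizers, until a new maximizer shows up: the maximum over the points
    decreases at least as fast as the value at a point of the polyhedron, and
    the process stops because there are ever more maximizers. *)
Lemma polyhedron_le_max w x :
  polyhedron cs x -> exists k, dot w x <= dot w (s k).
Proof.
move=> Px; have [n] := ubnP (#|K| - #|maximizers w|)%N.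
elim: n w => // n IHn w; rewrite ltnS => wn.
have [->|/faces[q qcs [qmax [k2 qk2]]]] := eqVneq w 0.
  by exists k0; rewrite !dot0l.
have [k1 _ k1max] := @seq_argmin _ (enum K) (fun k =>
  - dot w (s k)) k0 (mem_enum _ _).
have {}k1max k : dot w (s k) <= dot w (s k1).
  by rewrite -lerN2 k1max ?mem_enum.
exists k1; pose f k := (dot w (s k1) - dot w (s k)) / (q.2 - dot q.1 (s k)).
have [|k3] := @seq_argmin _ [seq k <- enum K | dot q.1 (s k) != q.2] f k2.
  by rewrite mem_filter qk2 mem_enum.
rewrite mem_filter mem_enum andbT => qk3 k3min.
have slack k : dot q.1 (s k) != q.2 -> 0 < q.2 - dot q.1 (s k).
  by move=> qk; rewrite subr_gt0 lt_neqAle qk s_poly.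
have f0 : 0 <= f k3 by rewrite divr_ge0 ?subr_ge0 // ltW // -subr_gt0 slack.
pose w' := w - f k3 *: q.1.
have w'E y : dot w' y = dot w y - f k3 * dot q.1 y by rewrite dotBl dotZl.
have w'le k : dot w' (s k) <= dot w (s k1) - f k3 * q.2.
  rewrite w'E; have [->|qk] := eqVneq (dot q.1 (s k)) q.2; first exact: lerB.
  have: f k3 <= f k by apply: k3min; rewrite mem_filter qk mem_enum.
  by rewrite ler_pdivlMr ?slack //; lra.
have w'eq k : dot w' (s k) = dot w (s k1) - f k3 * q.2 -> k \in maximizers w'.
  by move=> e; rewrite inE; apply/forallP => l; rewrite e.
have [|k kx] := IHn w'; last first.
  by have := le_trans kx (w'le k); rewrite w'E;
    have := ler_wpM2l f0 (Px q qcs); lra.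
suff lt : (#|maximizers w| < #|maximizers w'|)%N.
  by rewrite (leq_trans _ wn) // ltn_sub2l // (leq_trans lt) // max_card.
apply: proper_card; apply/properP; split.
  apply/subsetP => k kw; apply: w'eq; rewrite w'E qmax //; congr (_ - _).
  by apply/eqP; rewrite eq_le k1max; move: kw; rewrite inE => /forallP ->.
exists k3; last by apply: contra qk3 => /qmax->.
apply: w'eq; rewrite w'E /f; field.
by rewrite gt_eqF ?slack.
Qed.

(** Given a basic point x, apply polyhedron_le_max to the sum of the normals
    tight at x: a point that does at least as well as x is tight wherever x is,
    and so equals x. *)
Lemma polyhedron_conv x : bounded cs -> polyhedron cs x ->
  conv [set s k | k in [set: K]%classic]%classic x.
Proof.
move=> bcs Px; apply: conv_mono (sub_conv_basic_points bcs Px).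
move=> {Px}x [Px sx].
have [k] := polyhedron_le_max (\sum_(q <- tight cs x) q.1) Px.
rewrite !dot_suml -subr_ge0 -sumrB => xk; exists k => //.
apply/eqP; rewrite -subr_eq0; apply/eqP/sx => q qx.
have tE p : p \in tight cs x -> dot p.1 x = p.2 /\ p \in cs.
  by rewrite mem_filter => /andP[/eqP].
have le0 p : p \in tight cs x -> 0 <= dot p.1 x - dot p.1 (s k).
  by move=> /tE[-> pcs]; rewrite subr_ge0 s_poly.
have : \sum_(p <- tight cs x) (dot p.1 x - dot p.1 (s k)) = 0.
  apply/eqP; rewrite eq_le; apply/andP; split; last by rewrite big_seq sumr_ge0.
  by rewrite -oppr_ge0 -sumrN; under eq_bigr => p _ do rewrite opprB.
rewrite big_seq => /eqP; rewrite psumr_eq0 => [/allP/(_ q qx)|p];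
  last exact: le0.
by rewrite qx /= dotBr subr_eq0 => /eqP->; rewrite subrr.
Qed.

End Facets.
End Polyhedra.

(** * The rank of an edge set *)

Lemma finset_ind (T : finType) (P : {set T} -> Prop) :
  P set0 -> (forall x (A : {set T}), x \notin A -> P A -> P (x |: A)) ->
  forall A, P A.
Proof.
move=> P0 PU A; have [n] := ubnP #|A|; elim: n A => // n IHn A.
have [->//|[x xA]] := set_0Vmem A.
rewrite (cardsD1 x) xA ltnS => An; rewrite -(setD1K xA).
by apply: PU; rewrite ?setD11 //; apply: IHn.
Qed.

Section Rank.
Variables (V : finType) (G : sgraph V).
Implicit Types (u v : V) (e : edge G) (A B D F T : {set edge G}).
Implicit Types (U W : {set V}).

Lemma edge_ends e : exists u v, u != v /\ val e = [set u; v].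
Proof.
have /cards2P[u [v [uv euv]]] := introT eqP (edges_card2 (valP e)).
by exists u, v.
Qed.

Lemma adjP F u v :
  reflect (exists2 e, e \in F & val e = [set u; v]) (adj F u v).
Proof.
apply: (iffP exists_inP) => -[e eF /eqP euv]; exists e => //; exact/eqP.
Qed.

Lemma adj_sym F : symmetric (adj F).
Proof. by move=> u v; apply/adjP/adjP => -[e eF euv]; exists e;
  rewrite ?euv // setUC. Qed.

Lemma cadj_sym F : connect_sym (adj F).
Proof. exact/sym_connect_sym/adj_sym. Qed.

Lemma adjS A B : A \subset B -> subrel (adj A) (adj B).
Proof. by move=> /subsetP AB u v /adjP[e /AB eB euv]; apply/adjP; exists e. Qed.

Lemma cadjS A B : A \subset B -> subrel (connect (adj A)) (connect (adj B)).
Proof.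
by move=> AB; apply: connect_sub => u v uv; apply/connect1/(adjS AB).
Qed.

Lemma adj_setU1 e F u v x y : val e = [set u; v] ->
  adj (e |: F) x y = adj F x y || ([set x; y] == [set u; v]).
Proof.
move=> euv; apply/adjP/orP => [[f]|[/adjP[f fF fxy]|/eqP xy]].
- rewrite in_setU1 => /predU1P[->|fF fxy]; first by rewrite euv => ->; right.
  by left; apply/adjP; exists f.
- by exists f => //; rewrite in_setU1 fF orbT.
- by exists e; rewrite ?setU11 // xy.
Qed.

(** A path that starts in a closed set only sees the edges in this set. *)
Lemma connect_closed_sub (r r' : rel V) (a : {pred V}) x y :
  (forall x y, x \in a -> r x y -> (y \in a) && r' x y) ->
  x \in a -> connect r x y -> connect r' x y.
Proof.
move=> sub + /connectP[p pxp ->]; elim: p x pxp => //= z p IHp x.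
case/andP=> xz zp xa; have /andP[za r'xz] := sub _ _ xa xz.
exact: connect_trans (connect1 r'xz) (IHp _ zp za).
Qed.

Lemma eq_n_comp_closed (r r' : rel V) (a : {pred V}) :
  (forall x y, x \in a -> r x y -> (y \in a) && r' x y) ->
  (forall x y, x \in a -> r' x y -> (y \in a) && r x y) ->
  n_comp r a = n_comp r' a.
Proof.
move=> rr' r'r; apply: eq_card => x; rewrite !inE; apply: andb_id2r => xa.
rewrite /root; congr (odflt _ _ == _); apply: eq_pick => y.
by apply/idP/idP; apply: connect_closed_sub xa.
Qed.

(** Only the components of u and v change.  Their union a is closed for both
  edge
    sets, and it splits into one component or two. *)
Lemma ncomp_setU1 e F u v : val e = [set u; v] ->
  ncomp F = (ncomp (e |: F) + ~~ connect (adj F) u v)%N.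
Proof.
move=> euv; rewrite /ncomp.
pose a := closure (adj F) (pred2 u v).
have sF := @cadj_sym F; have sF' := @cadj_sym (e |: F).
have FS : F \subset e |: F by apply: subsetUr.
have ua : u \in a by apply/(subsetP (subset_closure _ _)); rewrite !inE eqxx.
have va : v \in a by apply/(subsetP (subset_closure _ _));
  rewrite !inE eqxx orbT.
have clF : closed (adj F) a by apply: closure_closed.
have uv' : connect (adj (e |: F)) u v.
  by apply/connect1; rewrite (adj_setU1 _ _ _ euv) eqxx orbT.
have clF' : closed (adj (e |: F)) a.
  apply: intro_closed => // x y; rewrite (adj_setU1 _ _ _ euv).
  case/orP=> [/clF->//|/eqP xy xa].
  by have := set22 x y; rewrite xy !inE => /orP[]/eqP->.
have aE : closure (adj (e |: F)) (pred2 u v) =i a.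
  move=> x; apply/idP/idP.
    move/existsP=> [y /andP[/= xy]]; rewrite !inE => yuv.
    rewrite (closed_connect clF' xy).
    by case/orP: yuv => /eqP->.
  move/existsP=> [y /andP[/= xy yuv]]; apply/existsP; exists y => /=.
  by apply/andP; split=> //; apply: (cadjS FS).
rewrite (n_compC a) [in RHS](n_compC a).
rewrite (_ : n_comp (adj (e |: F)) a = 1%N); last first.
  by have := n_comp_closure2 sF' u v; rewrite uv' /= => <-;
    apply/esym/eq_n_comp_r.
rewrite (_ : n_comp (adj F) a = (~~ connect (adj F) u v).+1); last first.
  exact: n_comp_closure2.
rewrite (_ : n_comp (adj (e |: F)) [predC a] = n_comp (adj F) [predC a]).
  by rewrite add1n addSn addnC addSn addnC.
apply: eq_n_comp_closed => x y; rewrite !inE => xa.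
  rewrite (adj_setU1 _ _ _ euv) => /orP[xy|/eqP xy].
    by rewrite -(clF _ _ xy) xa.
  case/negP: xa; have := set21 x y; rewrite xy !inE.
  by case/orP=> /eqP->.
by move=> xy; rewrite -(clF _ _ xy) xa (adjS FS).
Qed.

Lemma ncomp_le F : (ncomp F <= #|V|)%N.
Proof. exact: max_card. Qed.

Lemma rk_setU1 e F u v : val e = [set u; v] ->
  rk (e |: F) = (rk F + ~~ connect (adj F) u v)%N.
Proof.
move=> euv; rewrite /rk (ncomp_setU1 F euv); set b := nat_of_bool _.
have := ncomp_le F; rewrite (ncomp_setU1 F euv) -/b.
by move: (ncomp _) b #|V| => n b m; lia.
Qed.

Lemma connect_adj0 u v : connect (adj (set0 : {set edge G})) u v = (u == v).
Proof.
apply/connectP/eqP => [[[|x p] //= /andP[/adjP[e]]]|->]; last by exists [::].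
by rewrite inE.
Qed.

Lemma rk0 : rk (set0 : {set edge G}) = 0%N.
Proof.
apply/eqP; rewrite subn_eq0; apply/subset_leq_card/subsetP => u _.
rewrite !inE andbT; apply/eqP.
by have := connect_root (adj (set0 : {set edge G})) u;
  rewrite connect_adj0 => /eqP.
Qed.

(** Adding an edge raises the rank exactly when its ends are not yet connected,
    which is the rarer the more edges there are: marginal ranks decrease. *)
Lemma rk_diminish A B D : A \subset B ->
  (rk (B :|: D) + rk A <= rk (A :|: D) + rk B)%N.
Proof.
move=> AB; elim/finset_ind: D => [|e D _ IH]; first by rewrite !setU0 addnC.
have [u [v [_ euv]]] := edge_ends e.
rewrite !(setUCA _ [set e]) !(rk_setU1 _ euv) -!addnA !(addnC (nat_of_bool _))
  !addnA.
apply: leq_add => //; have := @cadjS _ _ (setSU D AB) u v.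
by case: (connect (adj (A :|: D)) u v) => [-> //|_]; apply: leq_b1.
Qed.

Lemma rk_submod A B : (rk (A :|: B) + rk (A :&: B) <= rk A + rk B)%N.
Proof.
have := @rk_diminish (A :&: B) A B (subsetIl _ _).
by rewrite (setUidPr (subsetIr A B)) [(rk A + _)%N]addnC.
Qed.

Lemma rk_setU_le A D : (rk A <= rk (A :|: D))%N.
Proof.
elim/finset_ind: D => [|e D _ IH]; first by rewrite setU0.
have [u [v [_ euv]]] := edge_ends e.
by rewrite setUCA (rk_setU1 _ euv) (leq_trans IH) ?leq_addr.
Qed.

Lemma rkS A B : A \subset B -> (rk A <= rk B)%N.
Proof. by move/setUidPr=> <-; apply: rk_setU_le. Qed.

Lemma rk_le_card F : (rk F <= #|F|)%N.
Proof.
elim/finset_ind: F => [|e F eF IH]; first by rewrite rk0.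
have [u [v [_ euv]]] := edge_ends e.
by rewrite (rk_setU1 _ euv) cardsU1 eF addnC leq_add ?leq_b1.
Qed.

Lemma acyclicS A B : A \subset B -> acyclic B -> acyclic A.
Proof.
move=> AB aB c c2 /andP[cA uc]; apply: (aB c c2); rewrite /ucycle uc andbT.
exact: sub_cycle (adjS AB) _ cA.
Qed.

(** The ends of an added edge e are not connected before: a simple path between
    them would be closed up by e to a cycle. *)
Lemma acyclic_rk F : acyclic F -> rk F = #|F|.
Proof.
elim/finset_ind: F => [|e F eF IH] aF; first by rewrite rk0 cards0.
have [u [v [uv euv]]] := edge_ends e.
rewrite (rk_setU1 _ euv) cardsU1 eF addnC IH; last first.
  exact: acyclicS (subsetUr _ _) aF.
congr (_ + _)%N; apply/eqP; rewrite eqb1; apply/negP.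
case/connectP => p up vp; case/shortenP: up vp => p' up' Up _ vp.
case: (aF (u :: p')); last first.
  rewrite /ucycle Up andbT /= rcons_path (sub_path _ up'); last first.
    exact/adjS/subsetUr.
  by rewrite -vp adj_sym (adj_setU1 _ _ _ euv) eqxx orbT.
case: p' up' vp Up => [|x [|y p']] //=; first by move=> _ vu;
  rewrite vu eqxx in uv.
rewrite andbT => /adjP[f fF fux] vx; move: eF.
suff -> : e = f by rewrite fF.
by apply: val_inj; rewrite euv fux vx.
Qed.

Lemma connected_spanning_ncomp F :
  connected_spanning F <-> ncomp F = 1%N.
Proof.
have sF := @cadj_sym F; split=> [[/card_gt0P[u _] cF]|F1].
  rewrite /ncomp -(eq_n_comp_r (a := connect (adj F) u)); last first.
    by move=> v; rewrite !inE cF.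
  exact: n_comp_connect.
split; first by rewrite (leq_trans _ (ncomp_le F)) ?F1.
move=> u v; apply/(fingraph.rootP sF).
have : (ncomp F <= 1)%N by rewrite F1.
rewrite /ncomp /n_comp_mem => /card_le1_eqP; apply; rewrite !inE;
  by rewrite (roots_root sF).
Qed.

Lemma rk_connected F : connected_spanning F -> rk F = #|V|.-1.
Proof. by move=> /connected_spanning_ncomp F1; rewrite /rk F1 subn1. Qed.

(** The edges spanned by a vertex set. *)
Definition induced U : {set edge G} := [set e : edge G | val e \subset U].

(** Each vertex outside U is a component of its own, and there is at least one
    component inside U. *)
Lemma rk_induced_le U : U != set0 -> (rk (induced U) < #|U|)%N.
Proof.
case/set0Pn=> u uU; rewrite /rk /ncomp (n_compC [in U]).
have out x y : x \notin U -> ~~ adj (induced U) x y.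
  move=> xU; apply/negP => /adjP[e]; rewrite inE => eU exy.
  by case/negP: xU; apply: (subsetP eU); rewrite exy set21.
have -> : n_comp (adj (induced U)) [predC [in U]] = (#|V| - #|U|)%N.
  rewrite -[#|V|](cardC [in U]) addKn; apply: eq_card => x.
  rewrite !inE; apply: andb_idl => xU; apply/eqP.
  have /connectP[[|y p] /=] := connect_root (adj (induced U)) x;
    first by move=> _ ->.
  by rewrite (negPf (out x y xU)).
have : (0 < n_comp (adj (induced U)) [in U])%N.
  apply/card_gt0P; exists (fingraph.root (adj (induced U)) u); rewrite !inE.
  have sI := @cadj_sym (induced U).
  rewrite roots_root //=.
  have cl : closed (adj (induced U)) [in U].
    apply: intro_closed => // x y xy xU; move: xy; rewrite adj_sym => xy.
    by apply: contraTT xy => yU; apply: out.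
  by rewrite -(closed_connect cl (connect_root _ u)).
have := max_card [in U]; rewrite -/(#|U|).
move: (n_comp _ _) => n; have : (0 < #|U|)%N by apply/card_gt0P; exists u.
move: #|U| #|V| => m k; lia.
Qed.

End Rank.

(** * The spanning tree polytope *)

Section SpanningTreePolytope.
Variables (R : realType) (V : finType) (G : sgraph V).
Implicit Types (e f : edge G) (A B F T : {set edge G}) (x d : vec R (edge G)).
Local Open Scope ring_scope.

Definition tree_ineqs : seq (equation R (edge G)) :=
  (- chi R [set: edge G], 1 - #|V|%:R)
    :: [seq (chi R F, (rk F)%:R) | F <- enum {set edge G}]
    ++ [seq (- chi R [set e], 0) | e <- enum {: edge G}].

Lemma tree_ineqs_ind (P : equation R (edge G) -> Prop) :
  P (- chi R setT, 1 - #|V|%:R) -> (forall F, P (chi R F, (rk F)%:R)) ->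
  (forall e, P (- chi R [set e], 0)) -> forall q, q \in tree_ineqs -> P q.
Proof.
move=> PE PF Pe q; rewrite inE mem_cat => /predU1P[->//|/orP[]/mapP[i _ ->//]].
Qed.

Lemma mem_tree_total : (- chi R setT, 1 - #|V|%:R) \in tree_ineqs.
Proof. exact: mem_head. Qed.

Lemma mem_tree_rk F : (chi R F, (rk F)%:R) \in tree_ineqs.
Proof.
by rewrite inE mem_cat (map_f (fun F => (chi R F, (rk F)%:R))) ?orbT ?mem_enum.
Qed.

Lemma mem_tree_ge0 e : (- chi R [set e], 0) \in tree_ineqs.
Proof.
rewrite inE mem_cat (map_f (fun e => (- chi R [set e], 0))) ?orbT //.
by rewrite mem_enum.
Qed.

Lemma tree_ineqsP x : polyhedron tree_ineqs x <->
  [/\ forall F, dot (chi R F) x <= (rk F)%:R, forall e, 0 <= x e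
    & #|V|%:R - 1 <= dot (chi R setT) x].
Proof.
split=> [Px|[xF xe xE]].
  split=> [F|e|]; first exact: Px (mem_tree_rk F).
    by have /= := Px _ (mem_tree_ge0 e); rewrite dotNl dot_chi1 oppr_le0.
  by have /= := Px _ mem_tree_total; rewrite dotNl lerNl opprB.
apply: tree_ineqs_ind => [|//|e] /=; rewrite dotNl.
  by rewrite lerNl opprB.
by rewrite dot_chi1 oppr_le0.
Qed.

Lemma tree_ineqs_bounded : bounded tree_ineqs.
Proof.
move=> d dle.
have dge0 e : 0 <= d e.
  by have /= := dle _ (mem_tree_ge0 e); rewrite dotNl dot_chi1 oppr_le0.
have /= := dle _ (mem_tree_rk setT).
rewrite dot_chi => dle0; apply/ffunP => e; rewrite [RHS]ffunE.
have /eqP : \sum_(f in [set: edge G]) d f = 0 by apply/eqP;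
  rewrite eq_le dle0 sumr_ge0.
by rewrite psumr_eq0 => [/allP/(_ e (mem_index_enum _))|//];
  rewrite inE => /eqP.
Qed.

Lemma spanning_tree_card T : spanning_tree T -> #|T| = #|V|.-1.
Proof. by case=> cT /acyclic_rk <-; apply: rk_connected. Qed.

Lemma spanning_tree_ineqs T :
  spanning_tree T -> polyhedron tree_ineqs (chi R T).
Proof.
move=> tT; have [[V0 _] aT] := tT; apply/tree_ineqsP; split=> [F|e|].
- rewrite dot_chi_chi ler_nat -(acyclic_rk (acyclicS (subsetIr F T) aT)).
  exact/rkS/subsetIl.
- by rewrite ffunE ler0n.
- by rewrite dot_chi_chi setTI spanning_tree_card // -subn1 natrB.
Qed.

(** Removing an edge of a cycle would keep the rank n - 1, which is more than
  the
    number of the remaining edges. *)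
Lemma connected_acyclic T : connected_spanning T -> #|T| = #|V|.-1 -> acyclic T.
Proof.
move=> cT cardT [|u [|v [|y p]]] //= _ /andP[].
rewrite /= => /and3P[/adjP[e eT euv] vy yp].
rewrite !inE !negb_or => /andP[/and3P[uv uy up] /andP[/andP[vNy vp] _]].
have sub q z : v \notin z :: q -> path (adj T) z q -> path (adj (T :\ e)) z q.
  move=> vq; apply: (sub_in_path (P := [pred w | w != v])); last first.
    by apply/allP => w wq; apply: contraNneq vq => <-.
  move=> a b; rewrite !inE => av bv /adjP[f fT fab]; apply/adjP; exists f => //.
  rewrite !inE fT andbT; apply/eqP => fe.
  by have := set22 u v;
    rewrite -euv -fe fab !inE eq_sym (negPf av) eq_sym (negPf bv).
have vy' : adj (T :\ e) v y.
  case/adjP: vy => f fT fvy; apply/adjP; exists f => //.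
  rewrite !inE fT andbT; apply/eqP => fe.
  have := set21 u v; rewrite -euv -fe fvy !inE => /orP[]/eqP uE;
    first by rewrite uE eqxx in uv.
  by rewrite uE eqxx in uy.
have : connect (adj (T :\ e)) u v.
  rewrite cadj_sym; apply: connect_trans (connect1 vy') _; apply/connectP.
  exists (rcons p u); last by rewrite last_rcons.
  apply: sub yp; rewrite !inE mem_rcons !inE !negb_or vNy vp andbT.
  by rewrite eq_sym.
move=> uvc; have := rk_setU1 (T :\ e) euv;
  rewrite uvc addn0 setD1K // rk_connected //.
move=> e1; have := rk_le_card (T :\ e);
  rewrite -e1 -cardT [X in (X <= _)%N](cardsD1 e) eT.
by rewrite ltnn.
Qed.

Lemma dot_chiUI A B d : dot (chi R (A :|: B)) d + dot (chi R (A :&: B)) d =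
  dot (chi R A) d + dot (chi R B) d.
Proof.
rewrite -!dotDl; congr (dot _ d); apply/ffunP => e; rewrite !ffunE !inE.
by case: (e \in A); case: (e \in B); rewrite /= ?addr0 ?add0r.
Qed.

(** The sets on which x attains the rank bound are closed under union and
    intersection: x(A) is modular and the rank is submodular. *)
Lemma rk_tightUI x A B : polyhedron tree_ineqs x ->
  dot (chi R A) x = (rk A)%:R -> dot (chi R B) x = (rk B)%:R ->
  dot (chi R (A :|: B)) x = (rk (A :|: B))%:R /\
  dot (chi R (A :&: B)) x = (rk (A :&: B))%:R.
Proof.
case/tree_ineqsP => xF _ _ xA xB.
have := rk_submod A B; rewrite -(ler_nat R) !natrD -xA -xB.
rewrite -dot_chiUI.
by have := xF (A :|: B); have := xF (A :&: B); split; lra.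
Qed.

Hypothesis Gconn : connected_graph G.

Lemma rk_setT : (rk [set: edge G])%:R = #|V|%:R - 1 :> R.
Proof. by have [V0 _] := Gconn; rewrite rk_connected // -subn1 natrB. Qed.

Lemma setT_tight x : polyhedron tree_ineqs x ->
  dot (chi R setT) x = (rk [set: edge G])%:R.
Proof.
case/tree_ineqsP => xF _ xE; apply/eqP; rewrite eq_le xF /=.
by rewrite rk_setT.
Qed.

(** If a basic point x had a fractional coordinate, a minimal tight set B with a
    fractional edge would have two of them, e and f, as x(B) is an integer.  By
    minimality every tight set contains both or none, so that x could be moved
    in the direction chi e - chi f. *)
Lemma basic_tree_integral x :
  basic_points tree_ineqs x -> integral x.
Proof.
case=> Px sx e0; apply: boolp.contrapT => /negP e0frac.
pose P B := (dot (chi R B) x == (rk B)%:R) && [exists e in B, x e \isn't a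
  Num.int].
have PT : P setT.
  by rewrite /P setT_tight // eqxx; apply/exists_inP; exists e0.
case: (arg_minnP (fun B : {set edge G} => #|B|) PT) =>
  B /andP[/eqP xB /exists_inP[e eB efrac]] Bmin.
have sub A f : f \in B -> x f \isn't a Num.int -> dot (chi R A) x = (rk A)%:R ->
    f \in A -> B \subset A.
  move=> fB ffrac xA fA; have [_ xAB] := rk_tightUI Px xA xB.
  have := Bmin (A :&: B); rewrite /P xAB eqxx => /(_ _)/= AB.
  apply/setIidPr/eqP; rewrite eqEcard subsetIr AB //; apply/exists_inP.
  by exists f; rewrite // inE fA.
have [f [fB fe ffrac]] : exists f, [/\ f \in B, f != e & x f \isn't a Num.int].
  apply: boolp.contrapT => nof; case/negP: efrac.
  have -> : x e = (rk B)%:R - \sum_(f in B | f != e) x f.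
    by rewrite -xB dot_chi (bigD1 e) //= addrK.
  rewrite rpredB ?rpred_nat ?rpred_sum // => f /andP[fB fe].
  by apply: boolp.contrapT => /negP ffrac; apply: nof; exists f.
pose d : vec R (edge G) := chi R [set e] - chi R [set f].
have : d e = 0.
  rewrite (sx d) ?ffunE // => q; rewrite mem_filter => /andP[/eqP + qcs].
  have dA A : dot (chi R A) d = (e \in A)%:R - (f \in A)%:R.
    by rewrite dotBr ![dot (chi R A) _]dotC !dot_chi1 !ffunE.
  elim/tree_ineqs_ind: qcs => [_|A xA|g]; rewrite /= ?dotNl ?dA.
  - by rewrite !inE subrr oppr0.
  - have [eA|eA] := boolP (e \in A).
      by rewrite (subsetP (sub A e eB efrac xA eA)) // subrr.
    have [fA|_] := boolP (f \in A); last by rewrite subrr.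
    by case/negP: eA; apply: (subsetP (sub A f fB ffrac xA fA)).
  - rewrite dot_chi1 => /eqP; rewrite oppr_eq0 => /eqP xg.
    have gN h : x h \isn't a Num.int -> h \in [set g] = false.
      by move=> hfrac; rewrite inE; apply: contraNF hfrac => /eqP->;
        rewrite xg rpred0.
    by rewrite !gN // subrr oppr0.
rewrite !ffunE !inE eqxx eq_sym (negPf fe) subr0 => /eqP.
by rewrite oner_eq0.
Qed.

(** An integral point is the incidence vector of a set T of n - 1 edges.  Since
    x(T) <= rk T, this set has rank n - 1, and so it is a spanning tree. *)
Lemma basic_tree_chi x : basic_points tree_ineqs x ->
  [set chi R T | T in [set T | spanning_tree T]]%classic x.
Proof.
move=> bx; have xint := basic_tree_integral bx; have [Px _] := bx.
have /tree_ineqsP[xF x0 xE] := Px.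
have x01 e : x e = (x e != 0)%:R.
  have : x e <= 1.
    rewrite -dot_chi1 (le_trans (xF _)) // -[1]/(1%:R) ler_nat.
    by rewrite (leq_trans (rk_le_card _)) ?cards1.
  have /intrP[z ze] := xint e; move: (x0 e); rewrite ze.
  rewrite ler0z -[1]/(1%:~R) ler_int intr_eq0.
  case: z {ze} => // -[|[|n]] //.
pose T := [set e | x e != 0].
have xT : chi R T = x by apply/ffunP => e; rewrite ffunE inE [RHS]x01.
exists T => //=.
have [V0 _] := Gconn.
have cardT : #|T| = #|V|.-1.
  apply/eqP; rewrite -(eqr_nat R) -subn1 natrB // -rk_setT -(setT_tight Px).
  by rewrite -[in eqbRHS]xT dot_chi_chi setTI.
have rkT : rk T = #|V|.-1.
  apply/eqP; rewrite eqn_leq -{1}(rk_connected Gconn) rkS ?subsetT //=.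
  by have := xF T; rewrite -{1}xT dot_chi_chi setIid ler_nat cardT.
have cT : connected_spanning T.
  apply/connected_spanning_ncomp; have := ncomp_le T.
  by move: rkT V0; rewrite /rk; lia.
by split=> //; apply: connected_acyclic.
Qed.

(** Edmonds' theorem on the bases of a matroid, for graphic matroids. *)
Lemma spanning_tree_polytopeP x :
  spanning_tree_polytope R G x <-> polyhedron tree_ineqs x.
Proof.
split=> [Px q qcs|Px].
  by apply: conv_le Px => _ [T tT <-]; apply: spanning_tree_ineqs qcs.
exact: conv_mono basic_tree_chi _ (sub_conv_basic_points tree_ineqs_bounded Px).
Qed.

End SpanningTreePolytope.

(** * Degrees and exchanges of matchings *)

Section Matchings.
Variables (V : finType) (G : sgraph V).
Implicit Types (u v : V) (e f : edge G) (A F M N : {set edge G}).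
Implicit Types (U W : {set V}).

Lemma edge_eq e u v :
  u \in val e -> v \in val e -> u != v -> val e = [set u; v].
Proof.
move=> ue ve uv; apply/esym/eqP;
  rewrite eqEcard (edges_card2 (valP e)) cards2 uv.
by rewrite subUset !sub1set ue ve.
Qed.

Definition deg M v : nat := #|M :&: star G v|.

Lemma degS M N v : M \subset N -> (deg M v <= deg N v)%N.
Proof. by move=> MN; apply/subset_leq_card/setSI. Qed.

Lemma deg_gt0 M v : reflect (exists2 e, e \in M & v \in val e) (0 < deg M v)%N.
Proof.
apply: (iffP card_gt0P) => [[e]|[e eM ve]]; first by rewrite !inE => /andP[];
  exists e.
by exists e; rewrite !inE eM.
Qed.

Lemma matching_degP M : matching M <-> forall v, (deg M v <= 1)%N.
Proof.
split=> [mM v|dM e f eM fM ef].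
  apply/card_le1_eqP => e f; rewrite !inE => /andP[eM ve] /andP[fM vf].
  apply/eqP; apply: contraT => fe; rewrite eq_sym in fe.
  by have /pred0P/(_ v) := mM e f eM fM fe; rewrite /= ve vf.
apply/pred0P => v /=; apply/negP => /andP[ve vf]; case/eqP: ef.
by have /card_le1_eqP := dM v; apply; rewrite !inE ?eM ?fM.
Qed.

Lemma matchingS M N : M \subset N -> matching N -> matching M.
Proof. by move=> /subsetP MN mN e f /MN eN /MN fN; apply: mN. Qed.

Lemma matching0 : matching (set0 : {set edge G}).
Proof. by move=> e f; rewrite inE. Qed.

Lemma matching1 e : matching [set e].
Proof. by move=> f g; rewrite !inE => /eqP-> /eqP->; rewrite eqxx. Qed.

Lemma sum_deg M U : (\sum_(v in U) deg M v = \sum_(e in M) #|U :&: val e|)%N.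
Proof.
have degE v : deg M v = (\sum_(e in M | v \in val e) 1)%N.
  by rewrite sum1dep_card; apply: eq_card => e; rewrite !inE.
under eq_bigr => v _ do rewrite degE.
rewrite (exchange_big_dep [in M]) //=; last by move=> v e _ /andP[].
apply: eq_bigr => e eM; rewrite sum1dep_card; apply: eq_card => v.
by rewrite !inE eM.
Qed.

Lemma induced_le_sum_deg M U :
  (2 * #|M :&: induced G U| <= \sum_(v in U) deg M v)%N.
Proof.
rewrite sum_deg (big_setID (induced G U)) /= mulnC -sum_nat_const.
rewrite (leq_trans _ (leq_addr _ _)) //; apply: leq_sum => e.
by rewrite !inE => /andP[_ /setIidPr->]; rewrite (edges_card2 (valP e)).
Qed.

Lemma induced_eq_sum_deg M U :
  (forall e, e \in M -> ~~ [disjoint val e & U] -> val e \subset U) ->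
  (2 * #|M :&: induced G U| = \sum_(v in U) deg M v)%N.
Proof.
move=> MU; rewrite sum_deg (big_setID (induced G U)) /= mulnC -sum_nat_const.
rewrite [X in (_ + X)%N]big1 ?addn0 => [|e].
  apply: eq_bigr => e.
  by rewrite !inE => /andP[_ /setIidPr->]; rewrite (edges_card2 (valP e)).
rewrite !inE => /andP[eU eM]; apply/eqP;
  rewrite cards_eq0 setI_eq0 disjoint_sym.
by apply: contraR eU; apply: MU.
Qed.

Lemma matching_induced_le M U :
  matching M -> (#|M :&: induced G U| <= #|U|./2)%N.
Proof.
move=> /matching_degP dM; have := induced_le_sum_deg M U.
have : (\sum_(v in U) deg M v <= #|U|)%N by rewrite -sum1_card leq_sum.
lia.
Qed.

(** The edges of F inside W connect W, so that their rank is at least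
    #|W| - 1. *)
Lemma card_component_le F t (W := [set v | connect (adj F) t v]) :
  (#|W| <= #|F :&: induced G W|.+1)%N.
Proof.
have sF := @cadj_sym _ G F; set FW := F :&: _.
have sFW := @cadj_sym _ G FW.
have con x : (x \in connect (adj FW) t) = (x \in W).
  rewrite [RHS]inE; apply/idP/idP; first exact/cadjS/subsetIl.
  apply: (@connect_closed_sub _ _ _ [in W]); last by rewrite inE.
  move=> y z; rewrite !inE => ty /[dup] /connect1 yz /adjP[e eF eyz].
  have tz := connect_trans ty yz; rewrite tz; apply/adjP; exists e => //.
  by rewrite !inE eF eyz subUset !sub1set !inE ty.
have := rk_le_card FW; rewrite /rk /ncomp (n_compC [in W]).
have -> : n_comp (adj FW) [in W] = 1%N.
  by rewrite -(n_comp_connect sFW t); apply: eq_n_comp_r => x; rewrite con.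
have : (n_comp (adj FW) [predC [in W]] <= #|[predC [in W]]|)%N.
  by apply/subset_leq_card/subsetP => x; rewrite !inE => /andP[].
have := cardC [in W]; rewrite -/(#|W|).
move: #|W| (n_comp _ _) #|FW| #|V| => a b c d.
move: #|_| => k; lia.
Qed.


(** The exchange of two matchings along alternating paths.  In the absence of
    edges that leave U, these paths need no explicit description. *)
Definition swap M N U := (M :\: induced G U) :|: (N :&: induced G U).

Section Swap.
Variables (M N : {set edge G}) (U : {set V}).
Hypothesis MU : forall e, e \in M -> ~~ [disjoint val e & U] -> val e \subset U.

Lemma deg_swap_in v : v \in U -> (deg (swap M N U) v <= deg N v)%N.
Proof.
move=> vU; apply/subset_leq_card/subsetP => e; rewrite !inE.
case/andP=> /orP[/andP[eU eM] ve|/andP[-> _] ->//]; case/negP: eU.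
by apply: MU => //; apply/pred0Pn; exists v; rewrite /= ve.
Qed.

Lemma deg_swap_out v : v \notin U -> (deg (swap M N U) v <= deg M v)%N.
Proof.
move=> vU; apply/subset_leq_card/subsetP => e; rewrite !inE.
case/andP=> /orP[/andP[eU ->] ->//|/andP[_ eU] ve].
by case/negP: vU; apply: (subsetP eU).
Qed.

Lemma matching_swap : matching M -> matching N -> matching (swap M N U).
Proof.
move=> /matching_degP dM /matching_degP dN; apply/matching_degP => v.
have [vU|vU] := boolP (v \in U); first exact: leq_trans (deg_swap_in vU) _.
exact: leq_trans (deg_swap_out vU) _.
Qed.

End Swap.

Lemma chi_swap (R : realType) M N U :
  (chi R (swap M N U) + chi R (swap N M U) = chi R M + chi R N)%R.
Proof.
apply/ffunP => e; rewrite !ffunE !inE.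
by case: (e \in M); case: (e \in N); case: (val e \subset U);
  rewrite /= ?addr0 ?add0r.
Qed.

End Matchings.

(** * Maximum-weight matchings *)

Section MaximumWeight.
Variables (R : realType) (V : finType) (G : sgraph V).
Implicit Types (u v : V) (e f : edge G) (A F M N : {set edge G}).
Implicit Types (U W : {set V}).
Implicit Types (w : vec R (edge G)).
Local Open Scope ring_scope.

Definition optimal w M := matching M /\
  forall N, matching N -> dot w (chi R N) <= dot w (chi R M).

(** The two swaps of M and N together weigh as much as M and N, and neither of
    them exceeds the maximum. *)
Lemma optimal_swap w M N U :
  (forall e, e \in M :|: N -> ~~ [disjoint val e & U] -> val e \subset U) ->
  optimal w M -> optimal w N -> optimal w (swap M N U).
Proof.
move=> MNU [mM oM] [mN oN].
have mMN : matching (swap M N U).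
  by apply: matching_swap => // e eM; apply: MNU; rewrite inE eM.
have mNM : matching (swap N M U).
  by apply: matching_swap => // e eN; apply: MNU; rewrite inE eN orbT.
split=> // M' mM'; have := congr1 (dot w) (chi_swap R M N U); rewrite !dotDr.
by have := oM _ mM'; have := oM _ mNM; have := oN _ mNM; lra.
Qed.

Lemma dot_chiU w A F : [disjoint A & F] ->
  dot w (chi R (A :|: F)) = dot w (chi R A) + dot w (chi R F).
Proof.
move=> AF; rewrite -dotDr; congr (dot w _); apply/ffunP => e;
  rewrite !ffunE inE.
have [eA|_] := boolP (e \in A); last by rewrite add0r.
by rewrite (disjointFr AF eA) addr0.
Qed.

Lemma dot_chiD1 w A e : e \in A ->
  dot w (chi R A) = w e + dot w (chi R (A :\ e)).
Proof.
move=> eA; rewrite -{1}(setD1K eA) dot_chiU; first by rewrite dotC dot_chi1.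
by rewrite disjoints1 setD11.
Qed.

Lemma optimal_ge0 w M e : optimal w M -> e \in M -> 0 <= w e.
Proof.
move=> [mM oM] eM; have := oM (M :\ e) (matchingS (subD1set _ _) mM).
by rewrite (dot_chiD1 w eM) lerDr.
Qed.

Lemma optimal_addable w M e u v :
  optimal w M -> val e = [set u; v] -> 0 < w e ->
  deg M u = 0%N -> deg M v = 0%N -> False.
Proof.
move=> [mM oM] euv we Mu Mv.
have eM : e \notin M.
  apply: contra_eqN Mu => eM; rewrite -lt0n; apply/deg_gt0; exists e => //.
  by rewrite euv set21.
suff mMe : matching (e |: M).
  have := oM _ mMe; rewrite dot_chiU ?disjoints1 // [dot w (chi R [set e])]dotC
    dot_chi1.
  lra.
have ends f x : f \in M -> x \in val f -> x \notin val e.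
  move=> fM xf; rewrite euv !inE; apply/negP => /orP[]/eqP xE.
    have : (0 < deg M u)%N by apply/deg_gt0; exists f; rewrite -?xE.
    by rewrite Mu.
  have : (0 < deg M v)%N by apply/deg_gt0; exists f; rewrite -?xE.
  by rewrite Mv.
move=> f g; rewrite !in_setU1 => /predU1P[->|fM] /predU1P[->|gM] fg.
- by rewrite eqxx in fg.
- by apply/pred0P => x /=; apply/negP => /andP[xe /(ends g x gM)/negP].
- by apply/pred0P => x /=; apply/negP => /andP[/(ends f x fM)/negP].
- exact: mM.
Qed.

(** Two vertices that no maximum-weight matching misses together. *)
Definition never_both_missed w u v :=
  forall M, optimal w M -> deg M u = 0%N -> deg M v = 0%N -> u = v.

(** Let M miss u and v, and let N miss t.  Every vertex has degree at most 2 in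
    the union of M and N, and t, u, v have degree at most 1.  Hence they do not
    all lie in the component W of t, which would be a path with three ends.  If
      u
    is not in W, then swapping M for N inside W gives a maximum-weight matching
    that misses t and u; likewise for v. *)
Lemma never_both_missed_trans w u t v :
  (exists2 N, optimal w N & deg N t = 0%N) ->
  never_both_missed w u t -> never_both_missed w t v -> never_both_missed w u v.
Proof.
move=> [N oN Nt] ut tv M oM Mu Mv; apply/eqP; apply: contraT => uv.
have uNt : u != t by apply: contraNneq uv => tE; rewrite tE; apply/eqP/(tv M);
  rewrite -?tE.
have tNv : t != v by apply: contraNneq uv => tE; rewrite -tE;
  apply/eqP/(ut M); rewrite ?tE.
pose W := [set x | connect (adj (M :|: N)) t x].
have inW x : (x \in W) = connect (adj (M :|: N)) t x by rewrite inE.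
have MNW e : e \in M :|: N -> ~~ [disjoint val e & W] -> val e \subset W.
  move=> eMN /pred0Pn[x /= /andP[xe xW]]; apply/subsetP => y ye.
  have [<-//|xy] := eqVneq x y; rewrite !inW in xW *.
  apply: (connect_trans xW); apply/connect1/adjP; exists e => //.
  exact: edge_eq.
have tW : t \in W by rewrite inW.
have oMN := optimal_swap MNW oM oN.
have MW e : e \in M -> ~~ [disjoint val e & W] -> val e \subset W.
  by move=> eM; apply: MNW; rewrite inE eM.
have swt : deg (swap M N W) t = 0%N.
  by apply/eqP; rewrite -leqn0 -Nt deg_swap_in.
have sw0 x : deg M x = 0%N -> x \notin W -> deg (swap M N W) x = 0%N.
  by move=> Mx xW; apply/eqP; rewrite -leqn0 -Mx deg_swap_out.
have [uW|/(sw0 _ Mu) swu] := boolP (u \in W); last first.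
  by rewrite (ut _ oMN swu swt) eqxx in uNt.
have [vW|/(sw0 _ Mv) swv] := boolP (v \in W); last first.
  by rewrite (tv _ oMN swt swv) eqxx in tNv.
(* The degrees in W sum to at most 2 * #|W| - 3, but a connected graph on W has
   at least #|W| - 1 edges. *)
have := card_component_le (M :|: N) t; rewrite -/W.
have [/matching_degP dM /matching_degP dN] := (oM.1, oN.1).
have : (\sum_(x in W) (deg M x + deg N x + (x \in [set u; v;
  t])) <= 2 * #|W|)%N.
  rewrite mulnC -sum_nat_const; apply: leq_sum => x _.
  have := dM x; have := dN x; rewrite !inE.
  by do 2?[case: eqP => [->|_] /=]; rewrite ?Mu ?Mv;
    do ?[case: eqP => [->|_] /=]; rewrite ?Nt; lia.
rewrite !big_split /=.
have -> : (\sum_(x in W) (x \in [set u; v; t]) = 3)%N.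
  have <- : #|[set u; v; t]| = 3%N.
    by rewrite setUC cardsU1 cards2 uv !inE negb_or [t == u]eq_sym uNt tNv.
  rewrite -sum1_card big_mkcond [RHS]big_mkcond /=; apply: eq_bigr => x _.
  have [_|xW] := boolP (x \in W); first by case: (x \in _).
  case: ifP => //; rewrite !inE => xE; case/negP: xW.
  by case/orP: xE => [/orP[]|] /eqP->.
have := induced_le_sum_deg M W; have := induced_le_sum_deg N W.
rewrite setIUl; have := (leq_card_setU (M :&: induced G W) (N :&: induced G
  W)).1.
move: (\sum_(x in W) deg M x)%N (\sum_(x in W) deg N x)%N.
move: #|M :&: induced G W :|: N :&: induced G W| #|M :&: induced G W|.
move: #|N :&: induced G W| #|W| => a b c d f g; lia.
Qed.

Definition positive w : {set edge G} := [set e | 0 < w e].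

(** Gallai's lemma, weighted: two ends of a positive edge are never both missed,
    as the edge could be added; transitivity extends this to connected pairs. *)
Lemma connect_never_both_missed w :
  (forall v, exists2 N, optimal w N & deg N v = 0%N) ->
  forall u v, connect (adj (positive w)) u v -> never_both_missed w u v.
Proof.
move=> miss u v /connectP[p]; elim: p u => [|x p IHp] u /=;
  first by move=> _ ->.
case/andP=> /adjP[e]; rewrite inE => we eux xp vp.
apply: never_both_missed_trans (miss x) _ (IHp x xp vp) => M oM Mu Mx.
by case: (optimal_addable oM eux we Mu Mx).
Qed.

Lemma optimal_positive w M : (forall e, 0 <= w e) -> optimal w M ->
  optimal w (M :&: positive w).
Proof.
move=> w0 [mM oM]; split; first exact: matchingS (subsetIl _ _) mM.
move=> N /oM/le_trans-> //; rewrite ![dot w _]dotC !dot_chi.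
rewrite (big_setID (positive w)) /= gerDl big1 // => e.
by rewrite !inE -leNgt => /andP[we _]; apply: le_anti; rewrite we w0.
Qed.

(** Take for U a component of the positive edges.  A maximum-weight matching
    misses at most one vertex of U, even if only its positive edges are kept,
      and
    the one that misses a given vertex of U shows that #|U| is odd. *)
Lemma optimal_component w e : (forall e, 0 <= w e) -> 0 < w e ->
  (forall v, exists2 N, optimal w N & deg N v = 0%N) ->
  exists U, [/\ odd #|U|, (1 < #|U|)%N &
    forall M, optimal w M -> #|M :&: induced G U| = #|U|./2].
Proof.
move=> w0 we miss; have [u [v [uv euv]]] := edge_ends e.
pose U := [set x | connect (adj (positive w)) u x].
have inU x : (x \in U) = connect (adj (positive w)) u x by rewrite inE.
have uU : u \in U by rewrite inU.
have vU : v \in U.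
  by rewrite inU; apply/connect1/adjP; exists e; rewrite ?inE.
have U1 : (1 < #|U|)%N by apply/card_gt1P; exists u, v.
have sumE M : M \subset positive w ->
    (2 * #|M :&: induced G U| = \sum_(x in U) deg M x)%N.
  move=> Mpos; apply: induced_eq_sum_deg => f fM /pred0Pn[x /= /andP[xf xU]].
  apply/subsetP => y yf; have [<-//|xy] := eqVneq x y; rewrite !inU in xU *.
  apply: (connect_trans xU); apply/connect1/adjP; exists f.
    exact: (subsetP Mpos).
  exact: edge_eq.
have lower M : optimal w M -> (#|U| <= (2 * #|(M :&: positive w) :&: induced G
  U|).+1)%N.
  move=> /(optimal_positive w0); set M' := M :&: _ => oM'.
  rewrite sumE ?subsetIr //; have /matching_degP dM' := oM'.1.
  have nm x y : x \in U -> y \in U -> deg M' x = 0%N -> deg M' y = 0%N -> x = y.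
    rewrite !inU => ux uy; apply: (connect_never_both_missed miss) => //.
    by apply: connect_trans uy; rewrite cadj_sym.
  have [/existsP[z /andP[zU /eqP z0]]|] := boolP [exists z, (z \in U) && (deg
    M' z == 0%N)].
    rewrite (cardsD1 z) zU add1n ltnS [leqRHS](bigD1 z) //= z0 add0n -sum1_card.
    rewrite [leqLHS](eq_bigl (fun x => (x \in U) && (x != z))); last first.
      by move=> x; rewrite !inE andbC.
    apply: leq_sum => x /andP[xU xz]; rewrite lt0n;
      apply: contraNN xz => /eqP x0.
    exact/eqP/nm.
  rewrite negb_exists => /forallP cov; apply: leqW;
    rewrite -sum1_card leq_sum // => x xU.
  by have := cov x; rewrite xU /= lt0n.
have oddU : odd #|U|.
  have [N oN Nu] := miss u; have := lower N oN; rewrite sumE ?subsetIr //.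
  have e2 := sumE (N :&: positive w) (subsetIr _ _).
  have /matching_degP dN := (optimal_positive w0 oN).1.
  have N'u : deg (N :&: positive w) u = 0%N.
    by apply/eqP; rewrite -leqn0 -Nu degS ?subsetIl.
  have : (\sum_(x in U) deg (N :&: positive w) x <= #|U|.-1)%N.
    rewrite (bigD1 u) //= N'u add0n (cardsD1 u) uU add1n /= -sum1_card.
    rewrite [leqRHS](eq_bigl (fun x => (x \in U) && (x != u))).
      exact: leq_sum.
    by move=> x; rewrite !inE andbC.
  rewrite -e2; move: #|_ :&: induced G U| #|U| U1 => a b; lia.
exists U; split=> // M oM; apply/eqP;
  rewrite eqn_leq (matching_induced_le _ oM.1) /=.
have := lower M oM.
have : (#|M :&: positive w :&: induced G U| <= #|M :&: induced G U|)%N.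
  by apply/subset_leq_card/setSI/subsetIl.
move: #|_ :&: induced G U| #|_ :&: induced G U| #|U| oddU => a b c; lia.
Qed.

End MaximumWeight.

(** * The matching polytope *)

Section MatchingPolytope.
Variables (R : realType) (V : finType) (G : sgraph V).
Implicit Types (u v : V) (e f : edge G) (A F M N : {set edge G}).
Implicit Types (U W : {set V}).
Implicit Types (w x : vec R (edge G)).
Local Open Scope ring_scope.

Definition matching_ineqs : seq (equation R (edge G)) :=
  [seq (- chi R [set e], 0) | e <- enum {: edge G}]
    ++ [seq (chi R (star G v), 1) | v <- enum V]
    ++ [seq (chi R (induced G U), (#|U|./2)%:R) | U <- enum {set V} & odd #|U|].

Lemma matching_ineqs_ind (P : equation R (edge G) -> Prop) :
  (forall e, P (- chi R [set e], 0)) -> (forall v, P (chi R (star G v), 1)) ->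
  (forall U, odd #|U| -> P (chi R (induced G U), (#|U|./2)%:R)) ->
  forall q, q \in matching_ineqs -> P q.
Proof.
move=> Pe Pv PU q; rewrite !mem_cat => /or3P[]/mapP[i + ->] //.
by rewrite mem_filter => /andP[oddU _]; apply: PU.
Qed.

Lemma mem_matching_ge0 e : (- chi R [set e], 0) \in matching_ineqs.
Proof.
by rewrite mem_cat (map_f (fun e => (- chi R [set e], 0))) ?orbT ?mem_enum.
Qed.

Lemma mem_matching_star v : (chi R (star G v), 1) \in matching_ineqs.
Proof.
by rewrite !mem_cat (map_f (fun v => (chi R (star G v), 1))) ?orbT ?mem_enum.
Qed.

Lemma mem_matching_odd U : odd #|U| ->
  (chi R (induced G U), (#|U|./2)%:R) \in matching_ineqs.
Proof.
move=> oddU; rewrite !mem_cat.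
rewrite (map_f (fun U => (chi R (induced G U), (#|U|./2)%:R))) ?orbT //.
by rewrite mem_filter oddU mem_enum.
Qed.

Lemma matching_ineqs_bounded : bounded matching_ineqs.
Proof.
move=> d dle.
have dge0 e : 0 <= d e.
  by have /= := dle _ (mem_matching_ge0 e); rewrite dotNl dot_chi1 oppr_le0.
apply/ffunP => e; rewrite [RHS]ffunE; have [u [v [_ euv]]] := edge_ends e.
have /= := dle _ (mem_matching_star u); rewrite dot_chi => dle0.
have /eqP : \sum_(f in star G u) d f = 0 by apply/eqP;
  rewrite eq_le dle0 sumr_ge0.
rewrite psumr_eq0 => [/allP/(_ e (mem_index_enum _))|//].
by rewrite inE euv set21 => /eqP.
Qed.

Lemma matching_ineqs_valid M :
  matching M -> polyhedron matching_ineqs (chi R M).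
Proof.
move=> mM; have /matching_degP dM := mM.
apply: matching_ineqs_ind => [e|v|U _] /=.
- by rewrite dotNl dot_chi1 ffunE oppr_le0 ler0n.
- by rewrite dot_chi_chi lern1 setIC; apply: dM.
- by rewrite dot_chi_chi ler_nat setIC matching_induced_le.
Qed.

Definition matchingb M := [forall v, (deg M v <= 1)%N].

Lemma matchingbP M : reflect (matching M) (matchingb M).
Proof. by apply: (iffP forallP) => /matching_degP. Qed.

Let incidence (M : {M : {set edge G} | matchingb M}) : vec R (edge G) :=
  chi R (val M).

(** A negative weight gives a nonnegativity constraint, and a vertex covered by
    all maximum-weight matchings gives a degree constraint.  If there are
      neither,
    a component of the positive edges gives an odd set constraint. *)
Lemma matching_faces w : w != 0 -> exists2 q, q \in matching_ineqs &
  (forall M, optimal w M -> dot q.1 (chi R M) = q.2) /\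
  (exists2 M, matching M & dot q.1 (chi R M) != q.2).
Proof.
move=> wn0.
have [/existsP[e we]|/existsPn w0] := boolP [exists e, w e < 0].
  exists (- chi R [set e], 0); rewrite ?mem_matching_ge0 //=; split=> [M oM|].
    rewrite dotNl dot_chi1 ffunE; case: (boolP (e \in M)); rewrite ?oppr0 //.
    by move=> /(optimal_ge0 oM); rewrite leNgt we.
  exists [set e]; first exact: matching1.
  by rewrite dotNl dot_chi1 ffunE set11 oppr_eq0 oner_eq0.
have {}w0 e : 0 <= w e by rewrite leNgt w0.
have m0 : matching (set0 : {set edge G}) by apply: matching0.
have d0 (a : vec R (edge G)) : dot a (chi R set0) = 0.
  by rewrite dotC dot_chi big_set0.
case: (boolp.EM (exists v, forall M, optimal w M -> deg M v != 0%N)) =>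
  [[v cov]|ncov].
  exists (chi R (star G v), 1); rewrite ?mem_matching_star //=; split=> [M oM|].
    have := cov M oM; have /matching_degP/(_ v) := oM.1.
    by rewrite dot_chi_chi setIC -/(deg M v); case: (deg M v) => [|[]].
  by exists set0 => //; rewrite d0 eq_sym oner_eq0.
have miss v : exists2 N, optimal w N & deg N v = 0%N.
  apply: boolp.contrapT => nm; apply: ncov; exists v => M oM.
  by apply/eqP => Mv; apply: nm; exists M.
have [e we] : exists e, 0 < w e.
  apply/existsP; apply: contraR wn0; rewrite negb_exists => /forallP wle.
  apply/eqP/ffunP => e; rewrite [RHS]ffunE; apply: le_anti.
  by rewrite w0 leNgt wle.
have [U [oddU U1 Umax]] := optimal_component w0 we miss.
exists (chi R (induced G U), (#|U|./2)%:R); first exact: mem_matching_odd.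
split=> /= [M oM|]; first by rewrite dot_chi_chi setIC Umax.
exists set0 => //; rewrite d0 eq_sym pnatr_eq0 -lt0n.
by rewrite half_gt0.
Qed.

(** Edmonds' matching polytope theorem. *)
Lemma matching_polytopeP x :
  matching_polytope R G x <-> polyhedron matching_ineqs x.
Proof.
split=> [Mx q qcs|Px].
  by apply: conv_le Mx => _ [M mM <-]; apply: matching_ineqs_valid qcs.
pose K := {M : {set edge G} | matchingb M}.
have k0 : K by exists set0; apply/matchingbP/matching0.
apply: (@conv_mono _ _ [set incidence k | k in [set: K]%classic]%classic).
  by move=> _ [k _ <-]; exists (val k) => //; apply/matchingbP/(valP k).
apply: polyhedron_conv k0 _ _ _ _ matching_ineqs_bounded Px.
  by move=> k; apply/matching_ineqs_valid/matchingbP/(valP k).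
move=> w /matching_faces[q qcs [qmax [M mM qM]]]; exists q => //; split.
  move=> k; rewrite inE => /forallP kmax; apply: qmax.
  split=> [|N mN]; first exact/matchingbP/(valP k).
  exact: (kmax (Sub N (introT (matchingbP N) mN))).
by exists (Sub M (introT (matchingbP M) mM)).
Qed.

End MatchingPolytope.

(** * Linear systems with a unique solution *)

Section LinearSystems.
Variables (R : realType) (I : finType).
Implicit Types (a d x y z : vec R I) (q : equation R I).
Implicit Types (S C : seq (equation R I)).
Local Open Scope ring_scope.

Lemma dot_span (X : seq (vec R I)) d : (forall a, a \in X -> dot a d = 0) ->
  forall a, a \in <<X>>%VS -> dot a d = 0.
Proof.
move=> Xd a; rewrite -[X]/(tval (in_tuple X)) => /coord_span->.
rewrite dot_suml big1 // => i _; rewrite dotZl Xd ?mulr0 //.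
by rewrite mem_nth.
Qed.

Lemma dim_vec : \dim {: vec R I} = #|I|.
Proof. by rewrite dimvf /dim /= muln1. Qed.

Definition dots (X : seq (vec R I)) d : 'rV[R]_(size X) := \row_i dot X`_i d.

Fact dots_is_linear X : linear (dots X).
Proof. by move=> t d y; apply/rowP => i; rewrite !mxE dotDr dotZr. Qed.

HB.instance Definition _ X := GRing.isLinear.Build R (vec R I)
  'rV[R]_(size X) *:%R (dots X) (@dots_is_linear X).

(** With fewer constraints than coordinates, the linear map of the scalar
  products
    with the normals would have a nonzero kernel. *)
Lemma separating_size S : separating S -> (#|I| <= size S)%N.
Proof.
move=> sS; pose X := [seq q.1 | q <- S].
have ker0 : ({: vec R I} :&: lker (linfun (dots X)) = 0)%VS.
  apply/eqP; rewrite -subv0; apply/subvP => d /memv_capP[_].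
  rewrite memv_ker lfunE /= memv0 => /eqP Xd.
  apply/eqP/sS => q /(map_f (fun q => q.1)) qX.
  have iX : (index q.1 X < size X)%N by rewrite index_mem.
  by have /rowP/(_ (Ordinal iX)) := Xd; rewrite !mxE /= nth_index.
have := dimvS (subvf (linfun (dots X) @: fullv)).
rewrite (limg_dim_eq ker0) dim_vec dimvf /dim /= mul1n size_map; exact.
Qed.

(** The normals span the space, so a vector orthogonal to them is orthogonal to
    itself. *)
Lemma free_separating (C : seq (equation R I)) :
  size C = #|I| -> free [seq q.1 | q <- C] -> separating C.
Proof.
move=> sC fC d Cd; apply: dot_self0; apply: (@dot_span [seq q.1 | q <- C]).
  by move=> _ /mapP[q qC ->]; apply: Cd.
suff -> : <<[seq q.1 | q <- C]>>%VS = fullv by apply: memvf.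
apply/eqP; rewrite eqEdim subvf dim_vec.
by move: fC; rewrite /free => /eqP->; rewrite size_map sC leqnn.
Qed.

Lemma span_free_sub S : exists C, [/\ {subset C <= S}, free [seq q.1 | q <- C]
  & <<[seq q.1 | q <- C]>>%VS = <<[seq q.1 | q <- S]>>%VS].
Proof.
elim: S => [|q S [C [CS fC spC]]]; first by exists [::]; rewrite nil_free.
have [qC|qC] := boolP (q.1 \in <<[seq q.1 | q <- C]>>%VS).
  exists C; split=> // [p /CS pS|]; first by rewrite inE pS orbT.
  by rewrite /= span_cons -spC; apply/esym/addv_idPr; rewrite -memvE.
exists (q :: C); split=> [p||]; last by rewrite /= !span_cons spC.
  by rewrite !inE => /predU1P[->|/CS->]; rewrite ?eqxx ?orbT.
by rewrite /= free_cons qC.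
Qed.

Lemma separating_free_sub S : separating S ->
  exists C : #|I|.-tuple (equation R I),
    free [seq q.1 | q <- C] /\ {subset C <= S}.
Proof.
move=> sS; have [C [CS fC spC]] := span_free_sub S.
have sC : separating C.
  move=> d Cd; apply: sS => q qS; apply: (@dot_span [seq q.1 | q <- C]).
    by move=> _ /mapP[p pC ->]; apply: Cd.
  by rewrite spC memv_span // map_f.
suff CI : size C == #|I| by exists (Tuple CI).
rewrite eqn_leq separating_size // andbT -dim_vec -(size_map (fun q => q.1) C).
by move: fC; rewrite /free => /eqP <-; apply/dimvS/subvf.
Qed.

(** A direction that keeps the tight constraints tight can be followed both
  ways,
    so that x would lie inside a segment of the polyhedron. *)
Lemma vertices_separating S x : bounded S ->
  vertices (polyhedron S) x -> separating (tight S x).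
Proof.
move=> bS [Px xv] d d0; apply/eqP; apply: contraT => dn0.
have [t t0 [Pt _]] := polyhedron_segment bS Px d0 dn0.
have [||s s0 [Ps _]] := @polyhedron_segment _ _ S x (- d) bS Px.
- by move=> q /d0 e; rewrite dotNr e oppr0.
- by rewrite oppr_eq0.
have ts : t + s != 0 by rewrite gt_eqF ?addr_gt0.
have [||/eqP + _] := xv _ _ (s / (t + s)) Pt Ps.
- by rewrite divr_gt0 ?addr_gt0 //= ltr_pdivrMr ?addr_gt0 // mul1r ltrDr.
- exact: segment_combination.
rewrite -subr_eq0 addrAC subrr add0r scaler_eq0 (gt_eqF t0) /= => /eqP d00.
by rewrite d00 eqxx in dn0.
Qed.

End LinearSystems.

(** * The vertices of Theta *)

Section ThetaVertices.
Variables (R : realType) (V : finType) (G : sgraph V).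
Implicit Types (u v : V) (e f : edge G) (A B F : {set edge G}) (U W : {set V}).
Implicit Types (x y z d : vec R (edge G)) (L : {set {set edge G}}).
Local Open Scope ring_scope.

Definition tight_sets x : {set {set edge G}} :=
  [set A | dot (chi R A) x == (rk A)%:R].

Definition chain L :=
  [forall A in L, forall B in L, (A \subset B) || (B \subset A)].

Lemma chainP L :
  reflect {in L &, forall A B, A \subset B \/ B \subset A} (chain L).
Proof.
apply: (iffP forall_inP) => [cL A B AL BL|cL A AL].
  by apply/orP; have /forall_inP := cL A AL; apply.
by apply/forall_inP => B BL; apply/orP/cL.
Qed.

Lemma maximal_chain_mem x C D :
  maxset (fun C => (C \subset tight_sets x) && chain C) C ->
  D \in tight_sets x -> {in C, forall B, B \subset D \/ D \subset B} -> D \in C.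
Proof.
move=> /maxsetP[/andP[/subsetP CT /chainP cC] Cmax] Dt DC.
rewrite -(Cmax (D |: C)) ?setU11 ?subsetUr //; apply/andP; split.
  by apply/subsetP => X; rewrite in_setU1 => /predU1P[->|/CT].
apply/chainP => X Y; rewrite !in_setU1 => /predU1P[->|XC] /predU1P[->|YC].
- by left.
- by case: (DC Y YC); [right|left].
- exact: DC.
- exact: cC.
Qed.

(** Uncrossing.  Let B' be the predecessor of B in a maximal chain C of tight
    sets.  For a tight set A, the tight set (A :&: B) :|: B' lies between B' and
    B and hence in C, so that chi (A :&: B) is a combination of members of C and
    chi (A :&: B'); induction along C leads to B = setT, where A :&: B = A. *)
Lemma maximal_chain_span x C d : polyhedron (tree_ineqs R G) x ->
  maxset (fun C => (C \subset tight_sets x) && chain C) C ->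
  {in C, forall B, dot (chi R B) d = 0} ->
  forall A B, A \in tight_sets x -> B \in C -> dot (chi R (A :&: B)) d = 0.
Proof.
move=> Px Cmax Cd A B At; have maxC := maximal_chain_mem Cmax.
have /maxsetP[/andP[/subsetP CT /chainP cC] _] := Cmax.
have tUI X Y : X \in tight_sets x -> Y \in tight_sets x ->
    X :|: Y \in tight_sets x /\ X :&: Y \in tight_sets x.
  rewrite !inE => /eqP Xt /eqP Yt.
  by have [-> ->] := rk_tightUI Px Xt Yt; rewrite !eqxx.
have t0 : set0 \in tight_sets x by rewrite inE dot_chi big_set0 rk0.
have C0 : set0 \in C by apply: maxC => // X _; right; apply: sub0set.
have [n] := ubnP #|B|; elim: n B => // n IHn B; rewrite ltnS => Bn BC.
have [->|Bn0] := eqVneq B set0; first by rewrite setI0 Cd.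
pose below X := (X \in C) && (X \proper B).
have below0 : below set0 by rewrite /below C0 proper0.
case: (arg_maxnP (fun X : {set edge G} => #|X|) below0) =>
  B' /andP[B'C B'B] B'max.
pose D := (A :&: B) :|: B'.
have DC : D \in C.
  apply: maxC => [|X XC].
    exact: (tUI _ _ (tUI _ _ At (CT _ BC)).2 (CT _ B'C)).1.
  have DB : D \subset B by rewrite subUset subsetIr proper_sub.
  have [BX|BX] := boolP (B \subset X); first by right;
    apply: subset_trans DB BX.
  left; have XB : X \proper B.
    by rewrite properE BX andbT; case: (cC X B XC BC) => // BX';
      rewrite BX' in BX.
  apply: subset_trans (subsetUr _ _).
  case: (cC X B' XC B'C) => // B'X; suff <- : B' = X by [].
  by apply/eqP; rewrite eqEcard B'X; apply: B'max; rewrite /below XC.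
have := dot_chiUI (A :&: B) B' d; rewrite -/D (Cd D DC) (Cd B' B'C) -setIA.
have AB'0 : dot (chi R (A :&: B')) d = 0.
  by apply: IHn => //; apply: leq_trans (proper_card B'B) Bn.
by rewrite (setIidPr (proper_sub B'B)) AB'0 !addr0 => <-.
Qed.

Definition theta_ineqs : seq (equation R (edge G)) :=
  tree_ineqs R G ++ [seq (chi R (star G v), 2) | v <- enum V].

Lemma theta_ineqsP x : polyhedron theta_ineqs x <->
  polyhedron (tree_ineqs R G) x /\ forall v, dot (chi R (star G v)) x <= 2.
Proof.
split=> [Px|[Px xv] q]; last first.
  by rewrite mem_cat => /orP[/Px//|/mapP[v _ ->]]; apply: xv.
split=> [q qt|v]; first by apply: Px; rewrite mem_cat qt.
apply: (Px (chi R (star G v), 2)).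
by rewrite mem_cat (map_f (fun v => (chi R (star G v), 2))) ?orbT ?mem_enum.
Qed.

Lemma theta_ineqs_bounded : bounded theta_ineqs.
Proof.
move=> d dle; apply: tree_ineqs_bounded => q qt.
by apply: dle; rewrite mem_cat qt.
Qed.

Hypothesis Gconn : connected_graph G.

(** For a point x of the spanning tree polytope the odd set inequalities of the
    matching polytope come for free at x / 2: the edges spanned by U have rank
    at most #|U| - 1. *)
Lemma ThetaP x : Theta R G x <-> polyhedron theta_ineqs x.
Proof.
rewrite theta_ineqsP; split=> [[/(spanning_tree_polytopeP Gconn) Px]|[Px xv]].
  case=> y /matching_polytopeP Py yx; split=> // v.
  have := Py _ (mem_matching_star R G v); rewrite -yx dotZr /=; lra.
split; first exact/(spanning_tree_polytopeP Gconn).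
have /tree_ineqsP[xF x0 _] := Px.
exists (2^-1 *: x); last by rewrite scalerA divff ?scale1r // pnatr_eq0.
apply/matching_polytopeP; apply: matching_ineqs_ind => [e|v|U oddU] /=;
  rewrite dotZr.
- by rewrite dotNl dot_chi1; have := x0 e; lra.
- by have := xv v; lra.
have U0 : U != set0 by apply: contraTneq oddU => ->; rewrite cards0.
have : ((rk (induced G U) + 1)%:R <= #|U|%:R :> R).
  by rewrite ler_nat addn1 rk_induced_le.
have <- : ((#|U|./2 * 2 + 1)%:R = #|U|%:R :> R).
  by rewrite -[in RHS](odd_double_half #|U|) oddU muln2 addnC.
by rewrite !natrD natrM; have := xF (induced G U); lra.
Qed.

(** A vertex of the polytope Theta is determined by its tight constraints, and
    the tight rank constraints can be replaced by those of a maximal chain. *)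
Lemma vertices_system_points x : vertices (Theta R G) x -> system_points R G x.
Proof.
have -> : Theta R G = polyhedron theta_ineqs.
  by apply/boolp.funext => y; apply/boolp.propext/ThetaP.
move=> xv; have sx := vertices_separating theta_ineqs_bounded xv.
have /theta_ineqsP[Px xdeg] := xv.1.
have [|C Cmax _] := @maxset_exists _ (fun C =>
  (C \subset tight_sets x) && chain C) set0.
  by rewrite sub0set; apply/chainP => A; rewrite inE.
pose L := C :\ set0 :\ setT; pose Z := [set e | x e == 0].
pose D := [set v | dot (chi R (star G v)) x == 2].
have /maxsetP[/andP[/subsetP CT /chainP cC] _] := Cmax.
have solved q : q \in theta_system R L Z D -> solves x q.
  rewrite inE !mem_cat => /predU1P[->|/or3P[]/mapP[i + ->]].
  - by rewrite /solves -/(dot _ _) setT_tight // rk_setT.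
  - by rewrite mem_enum !inE => /and3P[_ _ /CT]; rewrite inE => /eqP.
  - by rewrite mem_enum inE /solves -/(dot _ _) dot_chi1 => /eqP.
  - by rewrite mem_enum inE /solves -/(dot _ _) => /eqP.
have [|K [fK KS]] := @separating_free_sub _ _ (theta_system R L Z D).
  move=> d d0.
  have dT : dot (chi R setT) d = 0 by apply: (d0 (chi R setT, #|V|%:R - 1));
    apply: mem_head.
  have dC : {in C, forall B, dot (chi R B) d = 0}.
    move=> B BC; have [->//|BT] := eqVneq B setT.
    have [->|B0] := eqVneq B set0; first by rewrite dot_chi big_set0.
    apply: (d0 (chi R B, (rk B)%:R)); rewrite inE !mem_cat.
    by rewrite (map_f (fun F =>
      (chi R F, (rk F)%:R))) ?orbT // mem_enum !inE BT B0.
  have TC : setT \in C.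
    apply: (maximal_chain_mem Cmax) => [|B _]; last by left; apply: subsetT.
    by rewrite inE setT_tight.
  apply: sx => q; rewrite mem_filter mem_cat => /andP[/eqP qx /orP[]];
    last first.
    case/mapP=> v _ qE; rewrite {}qE /= in qx *;
      apply: (d0 (chi R (star G v), 2)).
    rewrite inE !mem_cat (map_f (fun v => (chi R (star G v), 2))) ?orbT //.
    by rewrite mem_enum inE qx.
  move=> qt; elim/tree_ineqs_ind: qt qx => [_|F xF|e] /=.
  - by rewrite dotNl dT oppr0.
  - by rewrite -[F]setIT (maximal_chain_span Px Cmax) // inE xF.
  - rewrite !dotNl !dot_chi1 => /eqP; rewrite oppr_eq0 => xe.
    have := d0 (chi R [set e], 0); rewrite /= dot_chi1 => -> //;
      first exact: oppr0.
    rewrite inE !mem_cat (map_f (fun e => (chi R [set e], 0))) ?orbT //.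
    by rewrite mem_enum inE.
exists K => [|q /KS/solved //].
split=> //; exists L, Z, D; split=> //.
- move=> A B; rewrite !inE => /and3P[_ _ AC] /and3P[_ _ BC].
  by case: (cC A B AC BC) => AB; [constructor 2|constructor 3].
- by rewrite !inE eqxx andbF.
- by rewrite !inE eqxx.
Qed.

(** Every equation of a system supports Theta from one side, so that a point
  inside
    a segment of Theta solves it only if both ends of the segment do. *)
Lemma theta_system_face L Z D q x : q \in theta_system R L Z D ->
  (forall y, Theta R G y -> dot q.1 y <= q.2) \/
  (forall y, Theta R G y -> q.2 <= dot q.1 y).
Proof.
have tree y : Theta R G y -> polyhedron (tree_ineqs R G) y.
  by move=> /ThetaP/theta_ineqsP[].
rewrite inE !mem_cat => /predU1P[->|/or3P[]/mapP[i _ ->]] /=.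
- by left=> y /tree Py; rewrite setT_tight // rk_setT.
- by left=> y /tree/tree_ineqsP[yF _ _]; apply: yF.
- by right=> y /tree/tree_ineqsP[_ y0 _]; rewrite dot_chi1.
- by left=> y /ThetaP/theta_ineqsP[_]; apply.
Qed.

Lemma system_points_vertices x :
  system_points R G x -> Theta R G x -> vertices (Theta R G) x.
Proof.
move=> [C [fC [L [Z [D [_ _ _ CS]]]]] Cx] Tx; split=> // y z t Ty Tz t01 xE.
have sC : separating C by apply: free_separating; rewrite ?size_tuple.
suff yz q : q \in C -> dot q.1 y = q.2 /\ dot q.1 z = q.2.
  have qx q : q \in C -> dot q.1 x = q.2 by move/Cx.
  split; apply/eqP; rewrite -subr_eq0; apply/eqP/sC => q qC.
    by rewrite dotBr (yz q qC).1 qx // subrr.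
  by rewrite dotBr (yz q qC).2 qx // subrr.
move=> qC; have : dot q.1 x = q.2 by apply: Cx.
have [/andP[t0 t1]] := t01; rewrite xE dotDr !dotZr.
have s0 : 0 < 1 - t by rewrite subr_gt0.
have convex_eq (a b c : R) : a <= c -> b <= c -> t * a + (1 - t) * b = c ->
    a = c /\ b = c.
  move=> ac bc abc.
  have : t * (c - a) + (1 - t) * (c - b) = 0 by rewrite -abc; ring.
  move/eqP; rewrite paddr_eq0 ?mulr_ge0 ?subr_ge0 ?(ltW t0) ?(ltW t1) //.
  by rewrite !mulf_eq0 (gt_eqF t0) (gt_eqF s0) /= !subr_eq0 =>
    /andP[/eqP <- /eqP <-].
case: (theta_system_face x (CS q qC)) => [le|ge];
  first exact: convex_eq (le _ Ty) (le _ Tz).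
move=> e; have [|||ey ez] := @convex_eq (- dot q.1 y) (- dot q.1 z) (- q.2).
- by rewrite lerN2 ge.
- by rewrite lerN2 ge.
- by rewrite -e; ring.
by split; apply: oppr_inj.
Qed.

End ThetaVertices.

(** * Denominators *)

Section LeastPositive.
Implicit Types (A B : set nat) (p k : nat).

Lemma least_posP A p : (0 < p)%N -> A p ->
  [/\ (0 < least_pos A)%N, A (least_pos A) &
    forall q, (0 < q)%N -> A q -> (least_pos A <= q)%N].
Proof.
move=> p0 Ap; rewrite /least_pos; set S := (X in xget _ X).
suff [m Sm] : exists m, S m by exact: (xgetPex 0%N (ex_intro _ m Sm)).
have ex : exists q, (0 < q)%N && boolp.asbool (A q).
  by exists p; rewrite p0; apply/boolp.asboolP.
case: (ex_minnP ex) => m /andP[m0 /boolp.asboolP Am] mmin.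
exists m; split=> // q q0 Aq; apply: mmin; rewrite q0; exact/boolp.asboolP.
Qed.

Lemma eq_least_pos A B :
  (forall k, (0 < k)%N -> A k <-> B k) -> least_pos A = least_pos B.
Proof.
move=> AB; rewrite /least_pos; congr (xget _ _).
apply/boolp.funext => p; apply/boolp.propext; split=> -[p0 Ap pmin]; split=> //.
- exact/AB.
- by move=> q q0 /AB-/(_ q0); apply: pmin.
- exact/AB.
- by move=> q q0 /AB-/(_ q0); apply: pmin.
Qed.

End LeastPositive.

Section Denominators.
Variables (R : realType) (I : finType).
Implicit Types (x y : vec R I) (P : set (vec R I)).
Local Open Scope ring_scope.

Lemma integralMn x k : integral x -> integral (k%:R *: x).
Proof. by move=> ix e; rewrite ffunE [_ *: _]mulr_natl rpredMn ?ix. Qed.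

Lemma integralB x y : integral x -> integral y -> integral (x - y).
Proof. by move=> ix iy e; rewrite !ffunE rpredB ?ix ?iy. Qed.

Section Rational.
Variables (x : vec R I) (p : nat).
Hypotheses (p_gt0 : (0 < p)%N) (px : integral (p%:R *: x)).

(** The numbers k for which k x is integral are closed under remainders, so that
    the least positive one divides all of them. *)
Lemma den_dvd k : (den x %| k)%N <-> integral (k%:R *: x).
Proof.
have [] := @least_posP [set k | integral (k%:R *: x)]%classic p p_gt0 px.
rewrite -/(den x) => d0 dx dmin.
split=> [/dvdnP[q ->]|kx].
  by rewrite natrM -scalerA; apply: integralMn.
rewrite /dvdn -leqn0 leqNgt; apply/negP => r0.
suff /(dmin _ r0) : integral ((k %% den x)%:R *: x) by rewrite leqNgt ltn_pmod.
have -> : (k %% den x)%:R *: x = k%:R *: x - (k %/ den x)%:R *: ((den x)%:R *: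
  x).
  rewrite scalerA -natrM -scalerBl; congr (_ *: x).
  by rewrite {2}(divn_eq k (den x)) natrD addrC addKr.
by apply: integralB => //; apply: integralMn.
Qed.

End Rational.

Lemma vertices_dilate P (k : nat) y : (0 < k)%N ->
  vertices (dilate k P) y <-> exists2 x, vertices P x & k%:R *: x = y.
Proof.
move=> k0; have kn0 : k%:R != 0 :> R by rewrite pnatr_eq0 -lt0n.
have kI : injective (fun x : vec R I =>
  k%:R *: x) by apply: can_inj (scalerK kn0).
have kE (a b : vec R I) t : k%:R *: (t *: a + (1 - t) *: b) =
    t *: (k%:R *: a) + (1 - t) *: (k%:R *: b).
  by rewrite scalerDr !scalerA ![k%:R * _]mulrC.
split=> [[[x Px <-] xv]|[x [Px xv] <-]].
  exists x => //; split=> // a b t Pa Pb t01 xE.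
  have [|||/kI-> /kI->//] := xv (k%:R *: a) (k%:R *: b) t _ _ t01.
  - by exists a.
  - by exists b.
  - by rewrite xE kE.
split; first by exists x.
move=> _ _ t [a Pa <-] [b Pb <-] t01;
  rewrite -kE => /kI /(xv _ _ _ Pa Pb t01)[-> ->].
by [].
Qed.

(** By Cramer's rule, a determinant is a common denominator of the solution of a
    regular system with integral right-hand side; when the entries are 0 and 1
    the Leibniz formula bounds it by m!. *)
Lemma regular_system_rational (C : #|I|.-tuple (equation R I)) x :
  separating C -> (forall q, q \in C -> exists F : {set I}, q.1 = chi R F) ->
  (forall q, q \in C -> q.2 \is a Num.int) ->
  (forall q, q \in C -> solves x q) ->
  exists2 p, (0 < p <= (#|I|)`!)%N & integral (p%:R *: x).
Proof.
move=> sC C1 C2 Cx.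
pose A : 'M[R]_#|I| := \matrix_(i, j) (tnth C i).1 (enum_val j).
have dotE i (y : 'cV[R]_#|I|) :
    dot (tnth C i).1 [ffun e => y (enum_rank e) ord0] = (A *m y) i ord0.
  rewrite !mxE /dot (reindex _ (onW_bij _ (enum_val_bij _))).
  by apply: eq_bigr => j _; rewrite ffunE enum_valK mxE.
have A01 i j : exists b : bool, A i j = b%:R.
  have [F FE] := C1 _ (mem_tnth i C).
  by exists (enum_val j \in F); rewrite mxE FE ffunE.
have detint : \det A \is a Num.int.
  apply: rpred_sum => s _; rewrite rpredMsign; apply: rpred_prod => i _.
  by have [b ->] := A01 i (s i); apply: rpred_nat.
have det0 : \det A != 0.
  apply/negP; rewrite -det_tr => /det0P[v v0 vA]; case/eqP: v0.
  have : [ffun e => v^T (enum_rank e) ord0] = 0 :> vec R I.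
    apply: sC => q /tnthP[i ->]; rewrite dotE -[A]trmxK -trmx_mul vA.
    by rewrite !mxE.
  move/ffunP => v0; apply/rowP => j; have := v0 (enum_val j).
  by rewrite !ffunE enum_valK !mxE.
have /intrP[z zE] := detint.
exists `|z|%N.
  rewrite lt0n absz_eq0 -(intr_eq0 R) -zE det0 /=.
  rewrite -(ler_nat R) natr_absz intr_norm -zE.
  have -> : (#|I|)`!%:R = \sum_(s : 'S_#|I|) 1 :> R by rewrite sumr_const
    card_Sn.
  apply: le_trans (ler_norm_sum _ _ _) _; apply: ler_sum => s _.
  rewrite normrM normr_sign mul1r normr_prod; apply: prodr_ile1 => i _;
    rewrite normr_ge0 /=.
  by have [[] ->] := A01 i (s i); rewrite ?normr1 ?normr0 ?lexx ?ler01.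
pose y : 'cV[R]_#|I| := \col_j x (enum_val j).
have yx : [ffun e => y (enum_rank e) ord0] = x.
  by apply/ffunP => e; rewrite ffunE mxE enum_rankK.
have zx e : \det A * x e \is a Num.int.
  have -> : \det A * x e = (\adj A *m (A *m y)) (enum_rank e) ord0.
    by rewrite mulmxA mul_adj_mx mul_scalar_mx !mxE enum_rankK.
  rewrite mxE; apply: rpred_sum => j _; apply: rpredM; last first.
    by rewrite -dotE yx; have := Cx _ (mem_tnth j C);
      rewrite /solves -/(dot _ _) => ->; apply/C2/mem_tnth.
  rewrite mxE /cofactor rpredMsign; apply: rpred_sum => s _.
  rewrite rpredMsign; apply: rpred_prod => i _; rewrite !mxE.
  by have := A01 (lift j i) (lift (enum_rank e) (s i));
    rewrite mxE => -[b ->]; apply: rpred_nat.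
move=> e; rewrite ffunE natr_absz intr_norm -zE.
by case: (ger0P (\det A)) => _; rewrite ?scaleNr ?rpredN; apply: zx.
Qed.

End Denominators.

(** The bound is the same for all points, which gives their denominators a
  common
    multiple. *)
Lemma system_points_rational (R : realType) (V : finType) (G : sgraph V)
    (x : vec R (edge G)) : system_points R G x ->
  exists2 p, (0 < p <= (#|{: edge G}|)`!)%N & integral (p%:R *: x)%R.
Proof.
move=> [C [fC [L [Z [D [_ _ _ CS]]]]] Cx].
apply: regular_system_rational Cx; first by apply: free_separating;
  rewrite ?size_tuple.
  move=> q /CS; rewrite inE !mem_cat => /predU1P[->|/or3P[]/mapP[i _ ->]] /=.
  - by exists setT.
  - by exists i.
  - by exists [set i].
  - by exists (star G i).
move=> q /CS; rewrite inE !mem_cat => /predU1P[->|/or3P[]/mapP[i _ ->]] /=.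
- by rewrite rpredB ?rpred1 ?rpred_nat.
- exact: rpred_nat.
- exact: rpred0.
- exact: rpred_nat.
Qed.

Local Open Scope classical_set_scope.

(* [0 < kG R G] makes all three numbers genuine, see [den] and [least_pos]. *)
Theorem corollary3p3 (R : realType) (V : finType) (G : sgraph V)
    (Gconn : connected_graph G) (Theta_neq0 : Theta R G !=set0) :
  [/\ (0 < kG R G)%N,
      kG R G = least_pos [set k | lattice_polytope (dilate k (Theta R G))]
    & kG R G = lcm_set [set den x | x in system_points R G `&` Theta R G]].
Proof.
have vE : vertices (Theta R G) = system_points R G `&` Theta R G.
  apply/boolp.funext => x; apply/boolp.propext; split=> [xv|[Sx Tx]].
    by split; [apply: vertices_system_points|case: xv].
  exact: system_points_vertices.
have rat x : vertices (Theta R G) x ->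
    exists2 p, (0 < p <= (#|{: edge G}|)`!)%N & integral (p%:R *: x)%R.
  by rewrite vE => -[/system_points_rational].
split.
(* K is a multiple of all positive integers up to m!. *)
- pose K := ((#|{: edge G}|)`!)`!%N.
  have [] // := @least_posP
    [set k | forall a, [set den x | x in vertices (Theta R G)] a -> (a %| k)%N]
      K.
    exact: fact_gt0.
  move=> _ [x /rat[p /andP[p0 pm] px] <-].
  by apply: dvdn_trans ((den_dvd p0 px p).2 px) _; rewrite dvdn_fact ?p0.
- apply: eq_least_pos => k k0 /=; split=> [denk y|lat _ [x xv <-]].
    move=> /(vertices_dilate _ _ k0)[x xv <-];
      have [p /andP[p0 _] px] := rat x xv.
    by apply/(den_dvd p0 px)/denk; exists x.
  have [p /andP[p0 _] px] := rat x xv; apply/(den_dvd p0 px)/lat.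
  by apply/(vertices_dilate _ _ k0); exists x.
- by rewrite -vE.
Qed.
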